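(* Let $k\in\{0,1,2,\dots\}\cup\{\infty\}$. Then each of the classes $U_2(T,k)$, $U_3(T,k)$, $U_4(T,k)$, $U_5(T,k)$ is a dense $G_\delta$ subset of $C^k(T)$.
   Context: $D=\{|z|<1\}$, $T=\{|z|=1\}$, $D(z_0,r)$ the open disk of center $z_0$ and radius $r$. For $k\in\{0,1,2,\dots\}\cup\{\infty\}$, $C^k(T)$ is the space of $u:T\to\mathbb{C}$ such that $\theta\mapsto u(e^{i\theta})$ is $k$ times continuously differentiable on $\mathbb{R}$, with the topology given by the seminorms $\sup_{\theta\in\mathbb{R}}|\frac{d^l}{d\theta^l}u(e^{i\theta})|$ for all integers $0\le l\le k$. For $z_0\in T$, $r>0$ let $\Omega(z_0,r)=D(z_0,r)\cap\{|z|>1\}$ and $P(z_0,r)=D(z_0,r)\cap D$. $U_2(T,z_0,k)$: the $u\in C^k(T)$ for which there exist no $r>0$ and no continuous $\lambda:T\cup\Omega(z_0,r)\to\mathbb{C}$ holomorphic on $\Omega(z_0,r)$ with $\lambda=u$ on $D(z_0,r)\cap T$. $U_3(T,z_0,k)$: the same with $P(z_0,r)$ in place of $\Omega(z_0,r)$. $U_4(T,z_0,k)=U_2(T,z_0,k)\cap U_3(T,z_0,k)$. $U_5(T,z_0,k)$: the $u\in C^k(T)$ for which there exist no $r>0$ and no holomorphic $F:D(z_0,r)\to\mathbb{C}$ with $F=u$ on $D(z_0,r)\cap T$. Finally $U_j(T,k)=\bigcap_{z_0\in T}U_j(T,z_0,k)$ for $j=2,3,4,5$. *)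

(* Defs.v *)
From Stdlib Require Import Reals.
Open Scope R_scope.

Definition Cx : Type := (R * R)%type.
Definition Cre (z : Cx) : R := fst z.
Definition Cim (z : Cx) : R := snd z.
Definition Cadd (z w : Cx) : Cx := (fst z + fst w, snd z + snd w).
Definition Csub (z w : Cx) : Cx := (fst z - fst w, snd z - snd w).
Definition Cmul (z w : Cx) : Cx :=
  (fst z * fst w - snd z * snd w, fst z * snd w + snd z * fst w).
Definition Cnorm (z : Cx) : R := sqrt (fst z * fst z + snd z * snd z).
Definition expi (t : R) : Cx := (cos t, sin t).

Definition onT (z : Cx) : Prop := Cnorm z = 1.
Definition Disk (z0 : Cx) (r : R) (z : Cx) : Prop := Cnorm (Csub z z0) < r.
Definition Omega (z0 : Cx) (r : R) (z : Cx) : Prop := Disk z0 r z /\ 1 < Cnorm z.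
Definition Pset (z0 : Cx) (r : R) (z : Cx) : Prop := Disk z0 r z /\ Cnorm z < 1.

Definition cont_on (S : Cx -> Prop) (f : Cx -> Cx) : Prop :=
  forall z, S z -> forall eps, 0 < eps -> exists delta, 0 < delta /\
    forall w, S w -> Cnorm (Csub w z) < delta -> Cnorm (Csub (f w) (f z)) < eps.

Definition holo_on (S : Cx -> Prop) (f : Cx -> Cx) : Prop :=
  forall z, S z -> exists l : Cx, forall eps, 0 < eps -> exists delta, 0 < delta /\
    forall w, S w -> Cnorm (Csub w z) < delta ->
      Cnorm (Csub (Csub (f w) (f z)) (Cmul l (Csub w z))) <= eps * Cnorm (Csub w z).

Inductive kreg : Type := Fin (n : nat) | Inf.
Definition le_k (l : nat) (k : kreg) : Prop :=
  match k with Fin n => (l <= n)%nat | Inf => True end.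
Definition lt_k (l : nat) (k : kreg) : Prop :=
  match k with Fin n => (l < n)%nat | Inf => True end.

Definition derivs (k : kreg) (g : R -> Cx) (d : nat -> R -> Cx) : Prop :=
  (forall t, d O t = g t) /\
  (forall l, le_k l k ->
     continuity (fun t => fst (d l t)) /\ continuity (fun t => snd (d l t))) /\
  (forall l, lt_k l k -> forall t,
     derivable_pt_lim (fun s => fst (d l s)) t (fst (d (S l) t)) /\
     derivable_pt_lim (fun s => snd (d l s)) t (snd (d (S l) t))).

(* u : T -> C is represented by a function Cx -> Cx whose values off T are
   irrelevant; u ∈ C^k(T) iff theta |-> u(e^{i theta}) is C^k on R. *)
Definition inCk (k : kreg) (u : Cx -> Cx) : Prop :=
  exists d, derivs k (fun t => u (expi t)) d.

(* Topology of C^k(T): generated by the seminorms sup_theta |d^l/dtheta^l u(e^{i theta})|,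
   0 <= l <= k.  A subset A of C^k(T) is open iff around each of its points it
   contains a basic neighbourhood {v : for all l <= N, sup |v^(l) - u^(l)| < eps}
   (N <= k finite, eps > 0). *)
Definition close (N : nat) (eps : R) (d e : nat -> R -> Cx) : Prop :=
  forall l, (l <= N)%nat -> forall t, Cnorm (Csub (e l t) (d l t)) < eps.

Definition Ck_open (k : kreg) (A : (Cx -> Cx) -> Prop) : Prop :=
  (forall u, A u -> inCk k u) /\
  forall u d, A u -> derivs k (fun t => u (expi t)) d ->
    exists N eps, le_k N k /\ 0 < eps /\
      forall v e, derivs k (fun t => v (expi t)) e -> close N eps d e -> A v.

Definition Ck_dense (k : kreg) (A : (Cx -> Cx) -> Prop) : Prop :=
  (forall u, A u -> inCk k u) /\
  forall u d N eps, derivs k (fun t => u (expi t)) d -> le_k N k -> 0 < eps ->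
    exists v e, A v /\ derivs k (fun t => v (expi t)) e /\ close N eps d e.

Definition Ck_Gdelta (k : kreg) (A : (Cx -> Cx) -> Prop) : Prop :=
  exists O : nat -> (Cx -> Cx) -> Prop,
    (forall n, Ck_open k (O n)) /\ (forall u, A u <-> forall n, O n u).

Definition dense_Gdelta (k : kreg) (A : (Cx -> Cx) -> Prop) : Prop :=
  Ck_dense k A /\ Ck_Gdelta k A.

Definition U2z (k : kreg) (z0 : Cx) (u : Cx -> Cx) : Prop :=
  inCk k u /\
  ~ (exists r, 0 < r /\ exists lam : Cx -> Cx,
       cont_on (fun z => onT z \/ Omega z0 r z) lam /\
       holo_on (Omega z0 r) lam /\
       (forall z, Disk z0 r z -> onT z -> lam z = u z)).

Definition U3z (k : kreg) (z0 : Cx) (u : Cx -> Cx) : Prop :=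
  inCk k u /\
  ~ (exists r, 0 < r /\ exists lam : Cx -> Cx,
       cont_on (fun z => onT z \/ Pset z0 r z) lam /\
       holo_on (Pset z0 r) lam /\
       (forall z, Disk z0 r z -> onT z -> lam z = u z)).

Definition U4z (k : kreg) (z0 : Cx) (u : Cx -> Cx) : Prop :=
  U2z k z0 u /\ U3z k z0 u.

Definition U5z (k : kreg) (z0 : Cx) (u : Cx -> Cx) : Prop :=
  inCk k u /\
  ~ (exists r, 0 < r /\ exists F : Cx -> Cx,
       holo_on (Disk z0 r) F /\
       (forall z, Disk z0 r z -> onT z -> F z = u z)).

Definition Uall (Uz : kreg -> Cx -> (Cx -> Cx) -> Prop) (k : kreg) (u : Cx -> Cx) : Prop :=
  forall z0, onT z0 -> Uz k z0 u.

(* Main.v *)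
Require Import Defs.
From Stdlib Require Import Reals Lra Lia Classical ClassicalEpsilon Cantor.
From Coquelicot Require Import Coquelicot.
Open Scope R_scope.

(* Suppose functions u_i, extending holomorphically from one side of an arc of T with a
   common bound and radius, converge uniformly to u on T.  By the two constants theorem
   their extensions are uniformly Cauchy near the centre of the arc, so u extends there
   too.  Hence the complement of the closure of each set of functions extending from a
   given point of a countable dense subset of T, with a given radius and bound, contains
   the class, and the intersection of these complements is the class.  For density, the
   lacunary series w = sum exp (- 4^n) cos (16^n t) extends nowhere from either side; for
   fixed u, at each point of the countable set, radius and side at most one c makes
   u + c w extend, so all but countably many c are good.
   The two constants theorem only needs the maximum principle for pointwise
   differentiable functions, which follows from the mean value property, that is from
   Goursat's lemma in polar coordinates. *)

(** Extensions are only pointwise differentiable inside and continuous up to the arc, so the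
    analysis rests on comparing moduli: a Schwarz bound takes the place of Cauchy's estimates when
    uniform limits are shown to be holomorphic. Polar coordinates send the centre to infinity and
    thus tolerate one exceptional point of mere continuity, exactly what a difference quotient has
    at its centre. Countability comes from continuity: an extension at [z0] is bounded near [z0],
    hence restricts to a bounded extension around a nearby point of the countable set. The outside
    is carried to the inside by reflection in T, and the full disk is covered by the two sides.
    Density is shown for the smallest class, U4. The series must be smooth and yet singular from
    both sides. Its real values make the two sides equivalent. The bases are tuned to each other:
    each coefficient is the fourth power of the preceding one, so that the square root lost in the
    two constants theorem still leaves its square; the frequency is the square of [4 ^ n], so that
    geometric decay at an interior point beats the square of [exp (- 4 ^ n)]. *)

(** * Bisection *)

Lemma dependent_choice (A : Type) (P : A -> Prop) (Q : A -> A -> Prop) (a : A) :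
  P a -> (forall x, P x -> exists y, P y /\ Q x y) ->
  exists f : nat -> A, f O = a /\ forall n, P (f n) /\ Q (f n) (f (S n)).
Proof.
  intros Ha H.
  set (next := fun x : {x | P x} =>
    let (y, Hy) := constructive_indefinite_description _ (H (proj1_sig x) (proj2_sig x)) in
    exist P y (proj1 Hy)).
  set (f := fix f n := match n with O => exist P a Ha | S m => next (f m) end).
  exists (fun n => proj1_sig (f n)). split; [reflexivity|].
  intros n. split; [exact (proj2_sig (f n))|].
  simpl. unfold next at 1. destruct constructive_indefinite_description as [y Hy]. apply Hy.
Qed.

Lemma nested_intervals (a b : nat -> R) :
  (forall n, a n <= b n) -> (forall n, a n <= a (S n)) -> (forall n, b (S n) <= b n) ->
  exists p, forall n, a n <= p <= b n.
Proof.
  intros Hab Ha Hb.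
  assert (Ha' : forall n m, (n <= m)%nat -> a n <= a m).
  { intros n m H. induction H as [|m H IH]; [lra|]. specialize (Ha m). lra. }
  assert (Hb' : forall n m, (n <= m)%nat -> b m <= b n).
  { intros n m H. induction H as [|m H IH]; [lra|]. specialize (Hb m). lra. }
  assert (Hmix : forall n m, a n <= b m).
  { intros n m. specialize (Ha' n (max n m) ltac:(lia)).
    specialize (Hb' m (max n m) ltac:(lia)). specialize (Hab (max n m)). lra. }
  destruct (completeness (fun x => exists n, x = a n)) as [p [H1 H2]].
  - exists (b O). intros x [n ->]. apply Hmix.
  - exists (a O), O. reflexivity.
  - exists p. intros n. split.
    + apply H1. exists n. reflexivity.
    + apply H2. intros x [m ->]. apply Hmix.
Qed.

Lemma exists_half_pow_lt (e : R) : 0 < e -> exists n, (1 / 2) ^ n < e.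
Proof.
  intros He. destruct (pow_lt_1_zero (1 / 2) ltac:(rewrite Rabs_pos_eq; lra) e He) as [n Hn].
  exists n. specialize (Hn n (le_n _)). rewrite Rabs_pos_eq in Hn; [exact Hn|].
  apply pow_le. lra.
Qed.

(* Cousin's lemma, where (x, y, k) stands for [x, x + k W] x [y, y + k H]. *)
Lemma rectangle_bisection (W H : R) (P : R -> R -> R -> Prop) (x0 y0 : R) :
  0 <= W -> 0 <= H ->
  (forall x y k, 0 < k ->
     P x y (k / 2) -> P (x + k / 2 * W) y (k / 2) ->
     P x (y + k / 2 * H) (k / 2) -> P (x + k / 2 * W) (y + k / 2 * H) (k / 2) -> P x y k) ->
  (forall p q, x0 <= p <= x0 + W -> y0 <= q <= y0 + H ->
     exists delta, 0 < delta /\ forall x y k, 0 < k < delta ->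
       x <= p <= x + k * W -> y <= q <= y + k * H ->
       x0 <= x -> x + k * W <= x0 + W -> y0 <= y -> y + k * H <= y0 + H -> P x y k) ->
  P x0 y0 1.
Proof.
  intros HW HH Hq Hloc. apply NNPP. intros Hn.
  set (inside := fun s : R * R * R => let '(x, y, k) := s in
    0 < k /\ x0 <= x /\ x + k * W <= x0 + W /\ y0 <= y /\ y + k * H <= y0 + H).
  destruct (dependent_choice (R * R * R)
    (fun s => inside s /\ let '(x, y, k) := s in ~ P x y k)
    (fun s s' => let '(x, y, k) := s in let '(x', y', k') := s' in
       k' = k / 2 /\ x <= x' /\ x' + k' * W <= x + k * W /\
       y <= y' /\ y' + k' * H <= y + k * H) (x0, y0, 1)) as [f [Hf0 Hf]].
  - simpl. repeat split; try lra. exact Hn.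
  - intros [[x y] k] [Hin HP]. simpl in Hin.
    assert (Hc : exists x' y', ~ P x' y' (k / 2) /\
      (x' = x \/ x' = x + k / 2 * W) /\ (y' = y \/ y' = y + k / 2 * H)).
    { apply NNPP. intros Hc. apply HP. apply Hq; [tauto|..];
        apply NNPP; intros HP'; apply Hc; do 2 eexists; repeat split; eauto. }
    destruct Hc as (x' & y' & HP' & Hx & Hy).
    assert (0 <= k / 2 * W) by nra. assert (0 <= k / 2 * H) by nra.
    exists (x', y', k / 2). simpl.
    destruct Hx as [-> | ->]; destruct Hy as [-> | ->]; repeat split; (lra || assumption).
  - set (X := fun n => fst (fst (f n))). set (Y := fun n => snd (fst (f n))).
    set (K := fun n => snd (f n)).
    assert (HK : forall n, K n = (1 / 2) ^ n).
    { induction n as [|n IH]; [unfold K; rewrite Hf0; reflexivity|].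
      destruct (Hf n) as [_ HQ]. unfold K in *.
      destruct (f n) as [[x y] k], (f (S n)) as [[x' y'] k']. simpl in *. rewrite <- IH. lra. }
    assert (Hin : forall n, inside (X n, Y n, K n) /\ ~ P (X n) (Y n) (K n)).
    { intros n. destruct (Hf n) as [HQ _]. unfold X, Y, K.
      destruct (f n) as [[x y] k]. exact HQ. }
    destruct (nested_intervals X (fun n => X n + K n * W)) as [p Hp].
    + intros n. destruct (Hin n) as [[Hk _] _]. nra.
    + intros n. destruct (Hf n) as [_ HQ]. unfold X.
      destruct (f n) as [[x y] k], (f (S n)) as [[x' y'] k']. simpl in *. lra.
    + intros n. destruct (Hf n) as [_ HQ]. unfold X, K.
      destruct (f n) as [[x y] k], (f (S n)) as [[x' y'] k']. simpl in *. lra.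
    + destruct (nested_intervals Y (fun n => Y n + K n * H)) as [q Hqq].
      * intros n. destruct (Hin n) as [[Hk _] _]. nra.
      * intros n. destruct (Hf n) as [_ HQ]. unfold Y.
        destruct (f n) as [[x y] k], (f (S n)) as [[x' y'] k']. simpl in *. lra.
      * intros n. destruct (Hf n) as [_ HQ]. unfold Y, K.
        destruct (f n) as [[x y] k], (f (S n)) as [[x' y'] k']. simpl in *. lra.
      * assert (H0 := Hp O). assert (H0' := Hqq O).
        unfold X, Y, K in H0, H0'. rewrite Hf0 in H0, H0'. simpl in H0, H0'.
        destruct (Hloc p q) as (delta & Hd & Hdelta); [lra|lra|].
        destruct (exists_half_pow_lt delta Hd) as [n Hn'].
        destruct (Hin n) as [Hi HP]. apply HP. simpl in Hi.
        apply Hdelta; try tauto; [|apply Hp|apply Hqq].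
        rewrite HK in *. split; [apply pow_lt; lra|exact Hn'].
Qed.

(** * Complex differentiability and compactness *)

Lemma Cnorm_Cmod (z : C) : Cnorm z = Cmod z.
Proof. unfold Cnorm, Cmod. f_equal. simpl. ring. Qed.

Definition cont_at (S : C -> Prop) (f : C -> C) (z : C) : Prop :=
  forall eps, 0 < eps -> exists delta, 0 < delta /\
    forall w, S w -> Cmod (w - z) < delta -> Cmod (f w - f z) < eps.

Definition cder (f : C -> C) (z l : C) : Prop :=
  forall eps, 0 < eps -> exists delta, 0 < delta /\
    forall w, Cmod (w - z) < delta -> Cmod (f w - f z - l * (w - z)) <= eps * Cmod (w - z).

Definition is_open (S : C -> Prop) : Prop :=
  forall z, S z -> exists r, 0 < r /\ forall w, Cmod (w - z) < r -> S w.

Lemma cont_on_iff (S : C -> Prop) (f : C -> C) :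
  cont_on S f <-> forall z, S z -> cont_at S f z.
Proof.
  split; intros H z Hz eps He; destruct (H z Hz eps He) as (d & Hd & Hw);
    exists d; (split; [exact Hd|]); intros w Sw Hwz; specialize (Hw w Sw);
    rewrite !Cnorm_Cmod in *; exact (Hw Hwz).
Qed.

(** Inside an open set [delta] can be shrunk until the whole disk lies in [S], so relative and full
    derivatives agree. *)
Lemma holo_on_iff (S : C -> Prop) (f : C -> C) :
  is_open S -> (holo_on S f <-> forall z, S z -> exists l, cder f z l).
Proof.
  intros HS. split; intros H z Hz; destruct (H z Hz) as [l Hl]; exists l; intros eps He;
    destruct (Hl eps He) as (d & Hd & Hw).
  - destruct (HS z Hz) as (r & Hr & HrS). exists (Rmin d r). split; [now apply Rmin_pos|].
    intros w Hwz. specialize (Hw w (HrS w (Rlt_le_trans _ _ _ Hwz (Rmin_r _ _)))).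
    rewrite !Cnorm_Cmod in Hw. exact (Hw (Rlt_le_trans _ _ _ Hwz (Rmin_l _ _))).
  - exists d. split; [exact Hd|]. intros w _ Hwz. rewrite !Cnorm_Cmod in *. exact (Hw w Hwz).
Qed.

(** The rules for sums, products and compositions are inherited through this equivalence. *)
Lemma cder_is_derive (f : C -> C) (z l : C) :
  cder f z l <-> @is_derive C_AbsRing (AbsRing_NormedModule C_AbsRing) f z l.
Proof.
  split.
  - intros H. split; [apply (@is_linear_scal_l C_AbsRing (AbsRing_NormedModule C_AbsRing))|].
    intros x Hx eps.
    assert (z = x) as <-.
    { apply (@is_filter_lim_locally_unique C_AbsRing (AbsRing_NormedModule C_AbsRing)).
      exact Hx. }
    destruct (H eps (cond_pos eps)) as (d & Hd & Hw).
    exists (mkposreal d Hd). intros w Hwz. specialize (Hw w Hwz).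
    change (Cmod (f w - f z - (w - z) * l) <= eps * Cmod (w - z)).
    now rewrite (Cmult_comm (w - z)).
  - intros [_ H] eps He.
    destruct (H z (fun P HP => HP) (mkposreal eps He)) as [d Hd].
    exists d. split; [apply cond_pos|]. intros w Hwz. specialize (Hd w Hwz).
    change (Cmod (f w - f z - (w - z) * l) <= eps * Cmod (w - z)) in Hd.
    now rewrite (Cmult_comm (w - z)) in Hd.
Qed.

Lemma cder_const (c z : C) : cder (fun _ => c) z 0.
Proof. apply cder_is_derive, (@is_derive_const C_AbsRing). Qed.

Lemma cder_id (z : C) : cder (fun w => w) z 1.
Proof. apply cder_is_derive, (@is_derive_id C_AbsRing). Qed.

Lemma cder_plus (f g : C -> C) (z l m : C) :
  cder f z l -> cder g z m -> cder (fun w => f w + g w)%C z (l + m).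
Proof.
  rewrite !cder_is_derive. intros Hf Hg.
  apply (@is_derive_plus C_AbsRing (AbsRing_NormedModule C_AbsRing) f g z l m Hf Hg).
Qed.

Lemma cder_mult (f g : C -> C) (z l m : C) :
  cder f z l -> cder g z m -> cder (fun w => f w * g w)%C z (l * g z + f z * m).
Proof.
  rewrite !cder_is_derive. intros Hf Hg.
  apply (@is_derive_mult C_AbsRing f g z l m Hf Hg). exact Cmult_comm.
Qed.

Lemma cder_comp (f g : C -> C) (z l m : C) :
  cder f (g z) l -> cder g z m -> cder (fun w => f (g w)) z (m * l).
Proof.
  rewrite !cder_is_derive. intros Hf Hg.
  apply (@is_derive_comp C_AbsRing (AbsRing_NormedModule C_AbsRing) f g z l m Hf Hg).
Qed.

Lemma cder_ext_loc (f g : C -> C) (z l : C) (r : R) :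
  0 < r -> (forall w, Cmod (w - z) < r -> f w = g w) -> cder f z l -> cder g z l.
Proof.
  intros Hr H Hf eps He. destruct (Hf eps He) as (d & Hd & Hw).
  exists (Rmin d r). split; [now apply Rmin_pos|]. intros w Hwz.
  rewrite <- !H.
  - apply Hw. eapply Rlt_le_trans; [exact Hwz|apply Rmin_l].
  - replace (z - z)%C with (RtoC 0) by ring. now rewrite Cmod_0.
  - eapply Rlt_le_trans; [exact Hwz|apply Rmin_r].
Qed.

Lemma cder_minus (f g : C -> C) (z l m : C) :
  cder f z l -> cder g z m -> cder (fun w => f w - g w)%C z (l - m).
Proof.
  intros Hf Hg.
  apply cder_ext_loc with (f := fun w => (f w + (- (1)) * g w)%C) (r := 1); [lra| |].
  - intros w _. ring.
  - replace (l - m)%C with (l + (0 * g z + (- (1)) * m))%C by ring.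
    apply cder_plus; [exact Hf|].
    apply (cder_mult (fun _ => (- (1))%C) g z 0 m); [apply cder_const|exact Hg].
Qed.

Lemma cder_pow (n : nat) (z : C) : exists l, cder (fun w => (w ^ n)%C) z l.
Proof.
  induction n as [|n [l IH]]; [exists 0%C; apply (cder_const 1)|].
  eexists. apply (cder_mult (fun w => w) (fun w => (w ^ n)%C)); [apply cder_id|exact IH].
Qed.

Lemma Cmod_sub_comm (z w : C) : Cmod (z - w) = Cmod (w - z).
Proof. replace (z - w)%C with (- (w - z))%C by ring. apply Cmod_opp. Qed.

Lemma Cmod_sub_triangle (x y z : C) : Cmod (x - z) <= Cmod (x - y) + Cmod (y - z).
Proof. replace (x - z)%C with ((x - y) + (y - z))%C by ring. apply Cmod_triangle. Qed.

Lemma Cmod_le_add_sub (x y : C) : Cmod x <= Cmod y + Cmod (x - y).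
Proof. replace x with (y + (x - y))%C at 1 by ring. apply Cmod_triangle. Qed.

Lemma Cmod_sub_self (z : C) : Cmod (z - z) = 0.
Proof. replace (z - z)%C with (RtoC 0) by ring. apply Cmod_0. Qed.

Lemma cder_cont_at (f : C -> C) (z l : C) (S : C -> Prop) : cder f z l -> cont_at S f z.
Proof.
  intros H eps He. destruct (H 1 Rlt_0_1) as (d & Hd & Hw).
  assert (Hl := Cmod_ge_0 l).
  exists (Rmin d (eps / (Cmod l + 2))). split.
  { apply Rmin_pos; [exact Hd|apply Rdiv_lt_0_compat; lra]. }
  intros w _ Hwz. specialize (Hw w (Rlt_le_trans _ _ _ Hwz (Rmin_l _ _))).
  assert (Hz : Cmod (w - z) < eps / (Cmod l + 2)).
  { eapply Rlt_le_trans; [exact Hwz|apply Rmin_r]. }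
  apply (Rmult_lt_compat_r (Cmod l + 2)) in Hz; [|lra].
  replace (eps / (Cmod l + 2) * (Cmod l + 2)) with eps in Hz by (field; lra).
  assert (Ht := Cmod_le_add_sub (f w - f z) (l * (w - z))). rewrite Cmod_mult in Ht.
  assert (H0 := Cmod_ge_0 (w - z)). nra.
Qed.

Lemma cont_at_sub (S S' : C -> Prop) (f : C -> C) (z : C) :
  (forall w, S' w -> S w) -> cont_at S f z -> cont_at S' f z.
Proof.
  intros HS H eps He. destruct (H eps He) as (d & Hd & Hw). exists d. auto.
Qed.

Lemma cont_at_const (S : C -> Prop) (c z : C) : cont_at S (fun _ => c) z.
Proof. apply (cder_cont_at _ z 0), cder_const. Qed.

Lemma cont_at_plus (S : C -> Prop) (f g : C -> C) (z : C) :
  cont_at S f z -> cont_at S g z -> cont_at S (fun w => f w + g w)%C z.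
Proof.
  intros Hf Hg eps He.
  destruct (Hf (eps / 2)) as (d & Hd & Hw); [lra|].
  destruct (Hg (eps / 2)) as (d' & Hd' & Hw'); [lra|].
  exists (Rmin d d'). split; [now apply Rmin_pos|]. intros w Sw Hwz.
  specialize (Hw w Sw (Rlt_le_trans _ _ _ Hwz (Rmin_l _ _))).
  specialize (Hw' w Sw (Rlt_le_trans _ _ _ Hwz (Rmin_r _ _))).
  replace (f w + g w - (f z + g z))%C with ((f w - f z) + (g w - g z))%C by ring.
  eapply Rle_lt_trans; [apply Cmod_triangle|lra].
Qed.

Lemma cont_at_mult (S : C -> Prop) (f g : C -> C) (z : C) :
  cont_at S f z -> cont_at S g z -> cont_at S (fun w => f w * g w)%C z.
Proof.
  intros Hf Hg eps He.
  assert (H1 := Cmod_ge_0 (f z)). assert (H2 := Cmod_ge_0 (g z)).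
  destruct (Hf (eps / (2 * (Cmod (g z) + 1)))) as (d & Hd & Hw).
  { apply Rdiv_lt_0_compat; lra. }
  destruct (Hg (Rmin 1 (eps / (2 * (Cmod (f z) + 1))))) as (d' & Hd' & Hw').
  { apply Rmin_pos; [lra|apply Rdiv_lt_0_compat; lra]. }
  exists (Rmin d d'). split; [now apply Rmin_pos|]. intros w Sw Hwz.
  specialize (Hw w Sw (Rlt_le_trans _ _ _ Hwz (Rmin_l _ _))).
  specialize (Hw' w Sw (Rlt_le_trans _ _ _ Hwz (Rmin_r _ _))).
  assert (Ha := Rlt_le_trans _ _ _ Hw' (Rmin_l _ _)).
  assert (Hb := Rlt_le_trans _ _ _ Hw' (Rmin_r _ _)).
  replace (f w * g w - f z * g z)%C with ((f w - f z) * g w + f z * (g w - g z))%C by ring.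
  eapply Rle_lt_trans; [apply Cmod_triangle|]. rewrite !Cmod_mult.
  assert (Hg1 := Cmod_le_add_sub (g w) (g z)).
  assert (H3 := Cmod_ge_0 (f w - f z)). assert (H4 := Cmod_ge_0 (g w - g z)).
  assert (Hw1 : Cmod (f w - f z) * (Cmod (g z) + 1) < eps / 2).
  { apply (Rmult_lt_compat_r (Cmod (g z) + 1)) in Hw; [|lra].
    replace (eps / 2) with (eps / (2 * (Cmod (g z) + 1)) * (Cmod (g z) + 1)) by (field; lra).
    exact Hw. }
  assert (Hw2 : Cmod (g w - g z) * (Cmod (f z) + 1) < eps / 2).
  { apply (Rmult_lt_compat_r (Cmod (f z) + 1)) in Hb; [|lra].
    replace (eps / 2) with (eps / (2 * (Cmod (f z) + 1)) * (Cmod (f z) + 1)) by (field; lra).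
    exact Hb. }
  nra.
Qed.

Lemma cont_at_minus (S : C -> Prop) (f g : C -> C) (z : C) :
  cont_at S f z -> cont_at S g z -> cont_at S (fun w => f w - g w)%C z.
Proof.
  intros Hf Hg eps He.
  destruct (cont_at_plus S f (fun w => (- (1)) * g w)%C z Hf) with (eps := eps)
    as (d & Hd & Hw); [apply cont_at_mult; [apply cont_at_const|exact Hg]|exact He|].
  exists d. split; [exact Hd|]. intros w Sw Hwz.
  replace (f w - g w - (f z - g z))%C with (f w + (- (1)) * g w - (f z + (- (1)) * g z))%C by ring.
  auto.
Qed.

Lemma Cmod_sqr (z : C) : Cmod z ^ 2 = fst z ^ 2 + snd z ^ 2.
Proof. apply Cmod2_alt. Qed.

Lemma Cmod_le_sum (z : C) : Cmod z <= Rabs (fst z) + Rabs (snd z).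
Proof.
  assert (H := Cmod_sqr z). assert (H0 := Cmod_ge_0 z).
  assert (Ha := Rabs_pos (fst z)). assert (Hb := Rabs_pos (snd z)).
  rewrite <- (pow2_abs (fst z)), <- (pow2_abs (snd z)) in H. nra.
Qed.

Lemma im_le_Cmod (z : C) : Rabs (snd z) <= Cmod z.
Proof. eapply Rle_trans; [apply Rmax_r|apply Rmax_Cmod]. Qed.

Lemma fst_le_Cmod (z : C) : Rabs (fst z) <= Cmod z.
Proof. exact (re_le_Cmod z). Qed.

(* Maximise by bisection: if no point of K were maximal, each small square would be
   dominated by a value of phi, hence so would the whole of K. *)
Lemma compact_max (K : C -> Prop) (phi : C -> R) (B : R) (z0 : C) :
  K z0 -> (forall z, K z -> Cmod z <= B) ->
  is_open (fun z => ~ K z) ->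
  (forall z, K z -> forall eps, 0 < eps -> exists delta, 0 < delta /\
     forall w, K w -> Cmod (w - z) < delta -> phi w < phi z + eps) ->
  exists p, K p /\ forall z, K z -> phi z <= phi p.
Proof.
  intros Hz0 HB Hcl Hphi. apply NNPP. intros Hn.
  assert (Hn' : forall p, K p -> exists q, K q /\ phi p < phi q).
  { intros p Hp. apply NNPP. intros H. apply Hn. exists p. split; [exact Hp|].
    intros z Hz. apply Rnot_lt_le. intros Hlt. apply H. eauto. }
  assert (HB0 : 0 <= B) by (specialize (HB _ Hz0); assert (H := Cmod_ge_0 z0); lra).
  set (P := fun x y k => exists q, K q /\ forall z, K z ->
    x <= fst z <= x + k * (2 * B) -> y <= snd z <= y + k * (2 * B) -> phi z <= phi q).
  assert (HP : P (- B) (- B) 1).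
  { apply rectangle_bisection with (W := 2 * B) (H := 2 * B); [lra|lra| |].
    - intros x y k Hk (q1 & K1 & H1) (q2 & K2 & H2) (q3 & K3 & H3) (q4 & K4 & H4).
      assert (Hm : exists q, K q /\ phi q1 <= phi q /\ phi q2 <= phi q /\
        phi q3 <= phi q /\ phi q4 <= phi q).
      { assert (Hmax : forall a b, K a -> K b -> exists q, K q /\ phi a <= phi q /\ phi b <= phi q).
        { intros a b Ka Kb. destruct (Rle_dec (phi a) (phi b)); [exists b|exists a]; repeat split; auto; lra. }
        destruct (Hmax q1 q2 K1 K2) as (a & Ka & Ha & Ha').
        destruct (Hmax q3 q4 K3 K4) as (b & Kb & Hb & Hb').
        destruct (Hmax a b Ka Kb) as (q & Kq & Hq & Hq'). exists q. repeat split; auto; lra. }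
      destruct Hm as (q & Kq & L1 & L2 & L3 & L4). exists q. split; [exact Kq|].
      intros z Kz Hx Hy.
      destruct (Rle_dec (fst z) (x + k / 2 * (2 * B))), (Rle_dec (snd z) (y + k / 2 * (2 * B)));
        [specialize (H1 z Kz)|specialize (H3 z Kz)|specialize (H2 z Kz)|specialize (H4 z Kz)];
        lra.
    - intros p1 p2 _ _. set (p := (p1, p2) : C).
      (* A square of side [k * (2 * B)] has coordinate differences adding up to at most [4 * B * k];
         the extra 1 covers [B = 0]. *)
      assert (Hsmall : forall x y k d z, 0 < d -> 0 < k < d / (4 * B + 1) ->
        x <= p1 <= x + k * (2 * B) -> y <= p2 <= y + k * (2 * B) ->
        x <= fst z <= x + k * (2 * B) -> y <= snd z <= y + k * (2 * B) -> Cmod (z - p) < d).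
      { intros x y k d z Hd [Hk Hk'] Hx Hy Hzx Hzy.
        eapply Rle_lt_trans; [apply Cmod_le_sum|]. simpl.
        assert (k * (4 * B + 1) < d).
        { apply (Rmult_lt_compat_r (4 * B + 1)) in Hk'; [|lra].
          replace (d / (4 * B + 1) * (4 * B + 1)) with d in Hk' by (field; lra). exact Hk'. }
        assert (Rabs (fst z + - p1) <= k * (2 * B)) by (apply Rabs_le; lra).
        assert (Rabs (snd z + - p2) <= k * (2 * B)) by (apply Rabs_le; lra). nra. }
      destruct (classic (K p)) as [Kp|Kp].
      + destruct (Hn' p Kp) as (q & Kq & Hq).
        destruct (Hphi p Kp (phi q - phi p)) as (d & Hd & Hw); [lra|].
        exists (d / (4 * B + 1)). split; [apply Rdiv_lt_0_compat; lra|].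
        intros x y k Hk Hx Hy _ _ _ _. exists q. split; [exact Kq|]. intros z Kz Hzx Hzy.
        specialize (Hw z Kz (Hsmall x y k d z Hd Hk Hx Hy Hzx Hzy)). lra.
      (* Near a point outside [K] the squares miss [K], so they are dominated vacuously and [z0]
         serves as witness. *)
      + destruct (Hcl p Kp) as (d & Hd & Hw).
        exists (d / (4 * B + 1)). split; [apply Rdiv_lt_0_compat; lra|].
        intros x y k Hk Hx Hy _ _ _ _. exists z0. split; [exact Hz0|]. intros z Kz Hzx Hzy.
        destruct (Hw z (Hsmall x y k d z Hd Hk Hx Hy Hzx Hzy) Kz). }
  destruct HP as (q & Kq & Hq). apply Hn. exists q. split; [exact Kq|].
  intros z Kz. specialize (HB z Kz).
  assert (H1 := fst_le_Cmod z). assert (H2 := im_le_Cmod z).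
  apply Hq; [exact Kz| |]; apply Rabs_le_between in H1, H2; lra.
Qed.

(** * Goursat's lemma *)

Lemma derivable_pt_lim_le (f : R -> R) (x l eps : R) :
  derivable_pt_lim f x l -> 0 < eps ->
  exists delta, 0 < delta /\
    forall h, Rabs h < delta -> Rabs (f (x + h) - f x - l * h) <= eps * Rabs h.
Proof.
  intros H He. destruct (H eps He) as [d Hd]. exists d. split; [apply cond_pos|].
  intros h Hh. destruct (Req_dec h 0) as [-> |Hh0].
  - rewrite Rplus_0_r, Rmult_0_r, !Rminus_diag, Rabs_R0. lra.
  - specialize (Hd h Hh0 Hh).
    replace (f (x + h) - f x - l * h) with (((f (x + h) - f x) / h - l) * h) by (field; exact Hh0).
    rewrite Rabs_mult. apply Rmult_le_compat_r; [apply Rabs_pos|lra].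
Qed.

(** * The complex exponential *)

Lemma exp_le_compat (x y : R) : x <= y -> exp x <= exp y.
Proof. intros [H| ->]; [left; now apply exp_increasing|lra]. Qed.

Definition cexp (z : C) : C := (exp (fst z) * cos (snd z), exp (fst z) * sin (snd z)).

Lemma cexp_plus (z w : C) : cexp (z + w) = (cexp z * cexp w)%C.
Proof.
  unfold cexp. simpl. rewrite exp_plus, cos_plus, sin_plus.
  apply injective_projections; simpl; ring.
Qed.

Lemma Cmod_cexp (z : C) : Cmod (cexp z) = exp (fst z).
Proof.
  assert (H := exp_pos (fst z)).
  apply Rsqr_inj; [apply Cmod_ge_0|lra|]. rewrite !Rsqr_pow2, Cmod_sqr. unfold cexp. simpl.
  assert (H1 := sin2_cos2 (snd z)). unfold Rsqr in H1. nra.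
Qed.

(** By [cexp_plus] the remainder at [z] is [cexp z] times the remainder at 0, hence the tolerance
    [eps / exp (fst z)]. At 0 it splits into the remainders of [exp], [cos] and [sin] and the
    product [x * y], which the bound [e / 32] on the step makes small. *)
Lemma cder_cexp (z : C) : cder cexp z (cexp z).
Proof.
  intros eps He.
  set (K := exp (fst z)). assert (HK : 0 < K) by apply exp_pos.
  set (e := eps / K). assert (He' : 0 < e) by (apply Rdiv_lt_0_compat; lra).
  destruct (derivable_pt_lim_le exp 0 (exp 0) (e / 16) (derivable_pt_lim_exp 0)) as (d1 & Hd1 & H1); [lra|].
  destruct (derivable_pt_lim_le cos 0 (- sin 0) (e / 16) (derivable_pt_lim_cos 0)) as (d2 & Hd2 & H2); [lra|].
  destruct (derivable_pt_lim_le sin 0 (cos 0) (e / 16) (derivable_pt_lim_sin 0)) as (d3 & Hd3 & H3); [lra|].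
  exists (Rmin (Rmin d1 d2) (Rmin d3 (Rmin 1 (e / 32)))). split.
  { repeat apply Rmin_pos; lra. }
  intros w Hw. set (h := (w - z)%C) in *.
  assert (Hm1 := Rmin_l (Rmin d1 d2) (Rmin d3 (Rmin 1 (e / 32)))).
  assert (Hm2 := Rmin_r (Rmin d1 d2) (Rmin d3 (Rmin 1 (e / 32)))).
  assert (Hm3 := Rmin_l d1 d2). assert (Hm4 := Rmin_r d1 d2).
  assert (Hm5 := Rmin_l d3 (Rmin 1 (e / 32))). assert (Hm6 := Rmin_r d3 (Rmin 1 (e / 32))).
  assert (Hm7 := Rmin_l 1 (e / 32)). assert (Hm8 := Rmin_r 1 (e / 32)).
  replace w with (z + h)%C by (unfold h; ring).
  replace (cexp (z + h) - cexp z - cexp z * h)%C with (cexp z * (cexp h - 1 - h))%C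
    by (rewrite cexp_plus; ring).
  rewrite Cmod_mult, Cmod_cexp. fold K.
  assert (Hh1 := fst_le_Cmod h). assert (Hh2 := im_le_Cmod h).
  destruct h as [x y]. set (m := Cmod (x, y)) in *. simpl in Hh1, Hh2.
  specialize (H1 x ltac:(lra)). specialize (H2 y ltac:(lra)). specialize (H3 y ltac:(lra)).
  rewrite Rplus_0_l in *. rewrite exp_0 in H1. rewrite cos_0, sin_0 in *.
  assert (HE : exp x <= 3).
  { eapply Rle_trans; [|apply exp_le_3]. apply exp_le_compat. apply Rabs_le_between in Hh1; lra. }
  assert (HE0 := exp_pos x).
  assert (Hmain : Cmod (cexp (x, y) - 1 - (x, y)) <= e * m).
  { eapply Rle_trans; [apply Cmod_le_sum|]. unfold cexp. simpl.
    replace (exp x * cos y + - (1) + - x)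
      with (exp x * (cos y - 1 - - 0 * y) + (exp x - 1 - 1 * x)) by ring.
    replace (exp x * sin y + - 0 + - y)
      with (exp x * (sin y - 0 - 1 * y) + ((exp x - 1 - 1 * x) * y + x * y)) by ring.
    assert (Hx0 := Rabs_pos x). assert (Hy0 := Rabs_pos y).
    assert (A1 : Rabs (exp x * (cos y - 1 - - 0 * y)) <= 3 * (e / 16 * m)).
    { rewrite Rabs_mult, (Rabs_pos_eq (exp x)) by lra. apply Rmult_le_compat; try lra.
      - apply Rabs_pos. - eapply Rle_trans; [exact H2|]. apply Rmult_le_compat_l; lra. }
    assert (A2 : Rabs (exp x * (sin y - 0 - 1 * y)) <= 3 * (e / 16 * m)).
    { rewrite Rabs_mult, (Rabs_pos_eq (exp x)) by lra. apply Rmult_le_compat; try lra.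
      - apply Rabs_pos. - eapply Rle_trans; [exact H3|]. apply Rmult_le_compat_l; lra. }
    assert (A3 : Rabs (exp x - 1 - 1 * x) <= e / 16 * m).
    { eapply Rle_trans; [exact H1|]. apply Rmult_le_compat_l; lra. }
    assert (A4 : Rabs ((exp x - 1 - 1 * x) * y) <= e / 16 * m).
    { rewrite Rabs_mult. rewrite <- (Rmult_1_r (e / 16 * m)).
      apply Rmult_le_compat; try apply Rabs_pos; lra. }
    assert (A5 : Rabs (x * y) <= e / 32 * m).
    { rewrite Rabs_mult. apply Rmult_le_compat; lra. }
    assert (T1 := Rabs_triang (exp x * (cos y - 1 - - 0 * y)) (exp x - 1 - 1 * x)).
    assert (T2 := Rabs_triang (exp x * (sin y - 0 - 1 * y)) ((exp x - 1 - 1 * x) * y + x * y)).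
    assert (T3 := Rabs_triang ((exp x - 1 - 1 * x) * y) (x * y)).
    assert (0 <= e * m) by (apply Rmult_le_pos; [lra|apply Cmod_ge_0]). lra. }
  apply (Rmult_le_compat_l K) in Hmain; [|lra].
  replace (K * (e * m)) with (eps * m) in Hmain by (unfold e; field; lra). exact Hmain.
Qed.

Section Goursat.

(** The half-plane is where the logarithmic coordinate of a punctured disk lives; [sigma] will be
    the logarithm of the radius. *)
Variables (F : C -> C) (sigma : R).
Hypothesis HF : forall z, fst z < sigma -> exists l, cder F z l.

Lemma Goursat_cont_fst (s t : R) : s < sigma -> continuous (fun t => fst (F (s, t))) t.
Proof.
  intros Hs P [eps HP]. destruct (HF (s, t) Hs) as [l Hl].
  destruct (cder_cont_at F _ l (fun _ => True) Hl eps (cond_pos eps)) as (d & Hd & Hw).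
  exists (mkposreal d Hd). intros t' Ht. apply HP.
  eapply Rle_lt_trans; [apply (fst_le_Cmod (F (s, t') - F (s, t)))|]. apply Hw; [exact I|].
  eapply Rle_lt_trans; [apply Cmod_le_sum|]. simpl. rewrite Rplus_opp_r, Rabs_R0, Rplus_0_l.
  exact Ht.
Qed.

Lemma Goursat_cont_snd (s t : R) : s < sigma -> continuous (fun s => snd (F (s, t))) s.
Proof.
  intros Hs P [eps HP]. destruct (HF (s, t) Hs) as [l Hl].
  destruct (cder_cont_at F _ l (fun _ => True) Hl eps (cond_pos eps)) as (d & Hd & Hw).
  exists (mkposreal d Hd). intros s' Ht. apply HP.
  eapply Rle_lt_trans; [apply (im_le_Cmod (F (s', t) - F (s, t)))|]. apply Hw; [exact I|].
  eapply Rle_lt_trans; [apply Cmod_le_sum|]. simpl. rewrite Rplus_opp_r, Rabs_R0, Rplus_0_r.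
  exact Ht.
Qed.

Lemma Goursat_ex_fst (s c d : R) : s < sigma -> ex_RInt (fun t => fst (F (s, t))) c d.
Proof.
  intros Hs. apply (ex_RInt_continuous (V := R_CompleteNormedModule)).
  intros t _. now apply Goursat_cont_fst.
Qed.

Lemma Goursat_ex_snd (t a b : R) :
  a < sigma -> b < sigma -> ex_RInt (fun s => snd (F (s, t))) a b.
Proof.
  intros Ha Hb. apply (ex_RInt_continuous (V := R_CompleteNormedModule)).
  intros s Hs. apply Goursat_cont_snd. apply Rle_lt_trans with (1 := proj2 Hs).
  now apply Rmax_lub_lt.
Qed.

(* The imaginary part of the boundary integral of F over [a, b] x [c, d]. *)
Definition Goursat_int (a b c d : R) : R :=
  RInt (fun t => fst (F (b, t)) - fst (F (a, t))) c d -
  RInt (fun s => snd (F (s, d)) - snd (F (s, c))) a b.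

Lemma Goursat_ex_fst2 (a b c d : R) : a < sigma -> b < sigma ->
  ex_RInt (fun t => fst (F (b, t)) - fst (F (a, t))) c d.
Proof.
  intros Ha Hb. apply (ex_RInt_minus (V := R_NormedModule)); now apply Goursat_ex_fst.
Qed.

Lemma Goursat_ex_snd2 (a b c d : R) : a < sigma -> b < sigma ->
  ex_RInt (fun s => snd (F (s, d)) - snd (F (s, c))) a b.
Proof.
  intros Ha Hb. apply (ex_RInt_minus (V := R_NormedModule)); now apply Goursat_ex_snd.
Qed.

Lemma Goursat_split_l (a m b c d : R) : a < sigma -> m < sigma -> b < sigma ->
  Goursat_int a b c d = Goursat_int a m c d + Goursat_int m b c d.
Proof.
  intros Ha Hm Hb. unfold Goursat_int.
  rewrite <- (RInt_Chasles (V := R_CompleteNormedModule) _ a m b)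
    by (now apply Goursat_ex_snd2).
  assert (E : RInt (fun t => fst (F (b, t)) - fst (F (a, t))) c d =
    RInt (fun t => fst (F (m, t)) - fst (F (a, t))) c d +
    RInt (fun t => fst (F (b, t)) - fst (F (m, t))) c d).
  { rewrite <- (RInt_plus (V := R_CompleteNormedModule)) by (now apply Goursat_ex_fst2).
    apply RInt_ext. intros t _. unfold plus; simpl. ring. }
  rewrite E. unfold plus; simpl. ring.
Qed.

Lemma Goursat_split_r (a b c m d : R) : a < sigma -> b < sigma ->
  Goursat_int a b c d = Goursat_int a b c m + Goursat_int a b m d.
Proof.
  intros Ha Hb. unfold Goursat_int.
  rewrite <- (RInt_Chasles (V := R_CompleteNormedModule) _ c m d)
    by (now apply Goursat_ex_fst2).
  assert (E : RInt (fun s => snd (F (s, d)) - snd (F (s, c))) a b =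
    RInt (fun s => snd (F (s, m)) - snd (F (s, c))) a b +
    RInt (fun s => snd (F (s, d)) - snd (F (s, m))) a b).
  { rewrite <- (RInt_plus (V := R_CompleteNormedModule)) by (now apply Goursat_ex_snd2).
    apply RInt_ext. intros t _. unfold plus; simpl. ring. }
  rewrite E. unfold plus; simpl. ring.
Qed.

(* Both parts of the linear approximation contribute [fst l * (b - a) * (d - c)],
   which is the Cauchy-Riemann equation. *)
Lemma Goursat_local (p l : C) (eps a b c d : R) :
  a <= fst p <= b -> c <= snd p <= d -> b < sigma ->
  (forall z, a <= fst z <= b -> c <= snd z <= d ->
     Cmod (F z - F p - l * (z - p)) <= eps * Cmod (z - p)) -> 0 <= eps ->
  Rabs (Goursat_int a b c d) <= 2 * eps * ((b - a) + (d - c)) ^ 2.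
Proof.
  intros Ha Hc Hb HE He.
  set (E := fun z => (F z - F p - l * (z - p))%C).
  set (L := b - a + (d - c)).
  assert (HL : forall z, a <= fst z <= b -> c <= snd z <= d -> Cmod (E z) <= eps * L).
  { intros z H1 H2. eapply Rle_trans; [now apply HE|]. apply Rmult_le_compat_l; [lra|].
    eapply Rle_trans; [apply Cmod_le_sum|]. unfold L. simpl.
    assert (Rabs (fst z + - fst p) <= b - a) by (apply Rabs_le; lra).
    assert (Rabs (snd z + - snd p) <= d - c) by (apply Rabs_le; lra). lra. }
  assert (I1 : Rabs (RInt (fun t => fst (F (b, t)) - fst (F (a, t))) c d -
     (d - c) * (fst l * (b - a))) <= (d - c) * (2 * (eps * L))).
  { rewrite <- (RInt_const (V := R_CompleteNormedModule) c d (fst l * (b - a)) : _ = (d - c) * _).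
    rewrite <- (RInt_minus (V := R_CompleteNormedModule));
      [|apply Goursat_ex_fst2; lra|apply (ex_RInt_const (V := R_NormedModule))].
    apply abs_RInt_le_const; [lra| |].
    - apply (ex_RInt_minus (V := R_NormedModule));
        [apply Goursat_ex_fst2; lra|apply (ex_RInt_const (V := R_NormedModule))].
    - intros t Ht. unfold minus, plus, opp; simpl.
      replace (fst (F (b, t)) - fst (F (a, t)) + - (fst l * (b - a)))
        with (fst (E (b, t)) - fst (E (a, t))) by (unfold E; simpl; ring).
      assert (A1 := fst_le_Cmod (E (b, t))). assert (A2 := fst_le_Cmod (E (a, t))).
      assert (B1 := HL (b, t) ltac:(simpl; lra) Ht). assert (B2 := HL (a, t) ltac:(simpl; lra) Ht).
      apply Rabs_le_between in A1, A2. apply Rabs_le. lra. }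
  assert (I2 : Rabs (RInt (fun s => snd (F (s, d)) - snd (F (s, c))) a b -
     (b - a) * (fst l * (d - c))) <= (b - a) * (2 * (eps * L))).
  { rewrite <- (RInt_const (V := R_CompleteNormedModule) a b (fst l * (d - c)) : _ = (b - a) * _).
    rewrite <- (RInt_minus (V := R_CompleteNormedModule));
      [|apply Goursat_ex_snd2; lra|apply (ex_RInt_const (V := R_NormedModule))].
    apply abs_RInt_le_const; [lra| |].
    - apply (ex_RInt_minus (V := R_NormedModule));
        [apply Goursat_ex_snd2; lra|apply (ex_RInt_const (V := R_NormedModule))].
    - intros t Ht. unfold minus, plus, opp; simpl.
      replace (snd (F (t, d)) - snd (F (t, c)) + - (fst l * (d - c)))
        with (snd (E (t, d)) - snd (E (t, c))) by (unfold E; simpl; ring).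
      assert (A1 := im_le_Cmod (E (t, d))). assert (A2 := im_le_Cmod (E (t, c))).
      assert (B1 := HL (t, d) Ht ltac:(simpl; lra)). assert (B2 := HL (t, c) Ht ltac:(simpl; lra)).
      apply Rabs_le_between in A1, A2. apply Rabs_le. lra. }
  unfold Goursat_int. fold L. apply Rabs_le_between in I1, I2.
  replace (2 * eps * L ^ 2) with ((d - c) * (2 * (eps * L)) + (b - a) * (2 * (eps * L)))
    by (unfold L; ring).
  apply Rabs_le. lra.
Qed.

(** The bound [2 * eps * (k * (W + H)) ^ 2] is quadratic in the scale, so the bounds of the four
    quarters add up to that of the whole, and differentiability at a point gives it for all small
    rectangles around that point. Bisection then proves it at scale 1, for every [eps]. *)
Lemma Goursat_rectangle (a b c d : R) :
  a <= b -> c <= d -> b < sigma -> Goursat_int a b c d = 0.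
Proof.
  intros Hab Hcd Hb. set (W := b - a). set (H := d - c).
  assert (Hall : forall eps, 0 < eps -> Rabs (Goursat_int a b c d) <= 2 * eps * (W + H) ^ 2).
  { intros eps He.
    assert (HP : a + 1 * W < sigma ->
      Rabs (Goursat_int a (a + 1 * W) c (c + 1 * H)) <= 2 * eps * (1 * (W + H)) ^ 2).
    { apply (rectangle_bisection W H (fun x y k => x + k * W < sigma ->
        Rabs (Goursat_int x (x + k * W) y (y + k * H)) <= 2 * eps * (k * (W + H)) ^ 2) a c).
      - unfold W; lra.
      - unfold H; lra.
      - intros x y k Hk H1 H2 H3 H4 Hs. assert (HW : 0 <= W) by (unfold W; lra).
        assert (0 <= k / 2 * W) by nra.
        replace (x + k / 2 * W + k / 2 * W) with (x + k * W) in * by field.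
        replace (y + k / 2 * H + k / 2 * H) with (y + k * H) in * by field.
        specialize (H1 ltac:(lra)). specialize (H2 ltac:(lra)).
        specialize (H3 ltac:(lra)). specialize (H4 ltac:(lra)).
        rewrite (Goursat_split_l x (x + k / 2 * W)) by lra.
        rewrite (Goursat_split_r x _ y (y + k / 2 * H)) by lra.
        rewrite (Goursat_split_r (x + k / 2 * W) _ y (y + k / 2 * H)) by lra.
        replace (2 * eps * (k * (W + H)) ^ 2) with (4 * (2 * eps * (k / 2 * (W + H)) ^ 2)) by field.
        apply Rabs_le_between in H1, H2, H3, H4. apply Rabs_le. lra.
      - intros p q Hp Hq. unfold W, H in Hp, Hq.
        destruct (HF (p, q)) as [l Hl]; [simpl; lra|].
        destruct (Hl eps He) as (dl & Hd & Hw).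
        exists (dl / (W + H + 1)). split; [apply Rdiv_lt_0_compat; unfold W, H; lra|].
        intros x y k [Hk Hk'] Hx Hy _ _ _ _ Hs.
        apply (Rmult_lt_compat_r (W + H + 1)) in Hk'; [|unfold W, H; lra].
        replace (dl / (W + H + 1) * (W + H + 1)) with dl in Hk' by (field; unfold W, H; lra).
        replace (k * (W + H)) with ((x + k * W - x) + (y + k * H - y)) by ring.
        apply Goursat_local with (p := (p, q)) (l := l); try assumption; [|lra].
        intros z Hz1 Hz2. apply Hw. eapply Rle_lt_trans; [apply Cmod_le_sum|]. simpl.
        assert (Rabs (fst z + - p) <= k * W) by (apply Rabs_le; lra).
        assert (Rabs (snd z + - q) <= k * H) by (apply Rabs_le; lra). lra. }
    replace (a + 1 * W) with b in HP by (unfold W; ring).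
    replace (c + 1 * H) with d in HP by (unfold H; ring).
    rewrite Rmult_1_l in HP. auto. }
  apply NNPP. intros Hn. assert (HJ := Rabs_pos_lt _ Hn).
  assert (HWH : 0 <= (W + H) ^ 2) by apply pow2_ge_0.
  (* With this [eps] the bound is at most half of the supposedly positive integral. *)
  specialize (Hall (Rabs (Goursat_int a b c d) / (4 * ((W + H) ^ 2 + 1)))).
  set (J := Rabs (Goursat_int a b c d)) in *. set (w := (W + H) ^ 2) in *.
  assert (J <= 2 * (J / (4 * (w + 1))) * w) by (apply Hall, Rdiv_lt_0_compat; lra).
  replace (2 * (J / (4 * (w + 1))) * w) with (J / 2 * (w / (w + 1))) in H0 by (field; lra).
  assert (w / (w + 1) <= 1) by (apply Rle_div_l; lra). nra.
Qed.

(** Periodicity cancels the horizontal sides, so the two vertical integrals agree. *)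
Lemma Goursat_periodic (a b d : R) :
  (forall s, F (s, d) = F (s, 0)) -> 0 <= d -> a <= b -> b < sigma ->
  RInt (fun t => fst (F (b, t))) 0 d = RInt (fun t => fst (F (a, t))) 0 d.
Proof.
  intros Hper Hd Hab Hb. assert (H := Goursat_rectangle a b 0 d Hab Hd Hb).
  unfold Goursat_int in H.
  rewrite (RInt_ext (V := R_CompleteNormedModule) (fun s => snd (F (s, d)) - snd (F (s, 0)))
     (fun _ => 0)) in H by (intros s _; rewrite Hper; apply Rminus_diag).
  rewrite (RInt_const (V := R_CompleteNormedModule)) in H.
  assert (E := RInt_minus (V := R_CompleteNormedModule) (fun t => fst (F (b, t)))
    (fun t => fst (F (a, t))) 0 d (Goursat_ex_fst b 0 d Hb) (Goursat_ex_fst a 0 d ltac:(lra))).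
  unfold minus, plus, opp, scal in *; simpl in *. unfold mult in *; simpl in *.
  assert (E' : RInt (fun t => fst (F (b, t)) - fst (F (a, t))) 0 d =
    RInt (fun t => fst (F (b, t))) 0 d + - RInt (fun t => fst (F (a, t))) 0 d) by exact E.
  lra.
Qed.

End Goursat.

(** * Maximum principle *)

(** [p + cexp z] never equals [p], so [f] may fail to be differentiable at the centre. *)
Lemma cder_polar (f : C -> C) (p : C) (r : R) : 0 < r ->
  (forall z, 0 < Cmod (z - p) < r -> exists l, cder f z l) ->
  forall z, fst z < ln r -> exists l, cder (fun z => f (p + cexp z)%C) z l.
Proof.
  intros Hr Hf z Hz. destruct (Hf (p + cexp z)%C) as [l Hl].
  - replace (p + cexp z - p)%C with (cexp z) by ring. rewrite Cmod_cexp.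
    split; [apply exp_pos|]. rewrite <- (exp_ln r) by exact Hr. now apply exp_increasing.
  - exists ((0 + cexp z) * l)%C. apply (cder_comp f (fun z => p + cexp z)%C); [exact Hl|].
    apply cder_plus; [apply cder_const|apply cder_cexp].
Qed.

(* By Goursat in the coordinate [ln (z - p)], the mean over the circle of radius rho
   does not depend on rho; then let rho tend to 0. *)
Lemma mean_value (f : C -> C) (p : C) (r s : R) : 0 < r -> s < ln r ->
  cont_at (fun _ => True) f p ->
  (forall z, 0 < Cmod (z - p) < r -> exists l, cder f z l) ->
  RInt (fun t => fst (f (p + cexp (s, t))%C)) 0 (2 * PI) = 2 * PI * fst (f p).
Proof.
  intros Hr Hs Hc Hf. assert (Hpi := PI_RGT_0).
  assert (HF := cder_polar f p r Hr Hf).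
  assert (Hall : forall eps, 0 < eps ->
    Rabs (RInt (fun t => fst (f (p + cexp (s, t))%C)) 0 (2 * PI) - 2 * PI * fst (f p))
      <= 2 * PI * eps).
  { intros eps He. destruct (Hc eps He) as (d & Hd & Hw).
    (* The circle of radius [exp s0] lies strictly within distance [d] of [p], where [f] is
       [eps]-close to [f p]. *)
    set (s0 := Rmin s (ln d - 1)).
    assert (Hs0 : s0 <= s) by apply Rmin_l.
    assert (Hs1 : s0 <= ln d - 1) by apply Rmin_r.
    rewrite (Goursat_periodic _ (ln r) HF s0 s (2 * PI)); [|..|lra|exact Hs0|exact Hs].
    2:{ intros s'. unfold cexp. simpl.
        rewrite <- (Rplus_0_l (2 * PI)). replace (2 * PI) with (2 * INR 1 * PI) by (simpl; ring).
        now rewrite cos_period, sin_period. }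
    assert (Hex : ex_RInt (fun t => fst (f (p + cexp (s0, t))%C)) 0 (2 * PI)).
    { apply (Goursat_ex_fst (fun z => f (p + cexp z)%C) (ln r) HF). lra. }
    assert (E : 2 * PI * fst (f p) = RInt (fun _ => fst (f p)) 0 (2 * PI)).
    { rewrite (RInt_const (V := R_CompleteNormedModule)). unfold scal; simpl. unfold mult; simpl.
      ring. }
    rewrite E.
    assert (E2 := RInt_minus (V := R_CompleteNormedModule) _ _ 0 (2 * PI) Hex
       (ex_RInt_const (V := R_NormedModule) 0 (2 * PI) (fst (f p)))).
    match goal with |- Rabs ?x <= _ => match type of E2 with _ = ?y => change (Rabs y <= 2 * PI * eps) end end.
    rewrite <- E2.
    replace (2 * PI * eps) with ((2 * PI - 0) * eps) by ring.
    apply abs_RInt_le_const; [lra| |].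
    - apply (ex_RInt_minus (V := R_NormedModule) _ _ _ _ Hex), (ex_RInt_const (V := R_NormedModule)).
    - intros t _. left.
      eapply Rle_lt_trans; [apply (fst_le_Cmod (f (p + cexp (s0, t))%C - f p))|].
      apply Hw; [exact I|]. replace (p + cexp (s0, t) - p)%C with (cexp (s0, t)) by ring.
      rewrite Cmod_cexp. rewrite <- (exp_ln d) by exact Hd. apply exp_increasing. simpl. lra. }
  apply NNPP. intros Hn. assert (Hn' := Rminus_eq_contra _ _ Hn). apply Rabs_pos_lt in Hn'.
  match type of Hn' with 0 < ?x =>
    specialize (Hall (x / (4 * PI)) ltac:(apply Rdiv_lt_0_compat; lra)); set (X := x) in * end.
  replace (2 * PI * (X / (4 * PI))) with (X / 2) in Hall by (field; lra). lra.
Qed.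

Lemma mean_value_no_peak (f : C -> C) (p : C) (r rho kappa : R) : 0 < rho < r ->
  cont_at (fun _ => True) f p ->
  (forall z, 0 < Cmod (z - p) < r -> exists l, cder f z l) ->
  (forall z, Cmod (z - p) = rho -> fst (f z) <= fst (f p) - kappa) -> kappa <= 0.
Proof.
  intros Hr Hc Hf Hk. assert (Hpi := PI_RGT_0).
  assert (Hln : ln rho < ln r) by (apply ln_increasing; lra).
  assert (H := mean_value f p r (ln rho) ltac:(lra) Hln Hc Hf).
  assert (Hle : RInt (fun t => fst (f (p + cexp (ln rho, t))%C)) 0 (2 * PI) <=
    RInt (fun _ => fst (f p) - kappa) 0 (2 * PI)).
  { apply RInt_le; [lra| | |].
    - apply (Goursat_ex_fst (fun z => f (p + cexp z)%C) (ln r)); [|exact Hln].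
      apply (cder_polar f p r); [lra|exact Hf].
    - apply (ex_RInt_const (V := R_NormedModule)).
    - intros t _. apply Hk. replace (p + cexp (ln rho, t) - p)%C with (cexp (ln rho, t)) by ring.
      rewrite Cmod_cexp. apply exp_ln. lra. }
  rewrite H, (RInt_const (V := R_CompleteNormedModule)) in Hle.
  unfold scal in Hle; simpl in Hle. unfold mult in Hle; simpl in Hle. nra.
Qed.

(** The real inner product, that is the real part of [Cconj a * z]. *)
Definition Cdot (a z : C) : R := fst a * fst z + snd a * snd z.

Lemma Cmod_sqr_shift (p z : C) :
  Cmod z ^ 2 = Cmod p ^ 2 + 2 * Cdot p (z - p) + Cmod (z - p) ^ 2.
Proof. rewrite !Cmod_sqr. unfold Cdot. simpl. ring. Qed.

Lemma Cdot_le (a z : C) : 2 * Cdot a z <= Cmod a ^ 2 + Cmod z ^ 2.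
Proof.
  rewrite !Cmod_sqr. unfold Cdot.
  assert (H1 := pow2_ge_0 (fst a - fst z)). assert (H2 := pow2_ge_0 (snd a - snd z)). nra.
Qed.

(* At a maximum p of [|f|^2 + e |z|^2] the holomorphic function
   [conj (f p) * f + e * conj p * z] has a strict peak of its real part, which the
   mean value property forbids. *)
Lemma max_principle (K S : C -> Prop) (f : C -> C) (B m : R) (z0 : C) :
  (forall z, K z -> Cmod z <= B) -> is_open (fun z => ~ K z) ->
  (forall z, K z -> cont_at K f z) ->
  (forall p, S p -> exists r, 0 < r /\ (forall z, Cmod (z - p) < r -> K z) /\
     forall z, 0 < Cmod (z - p) < r -> exists l, cder f z l) ->
  0 <= m -> (forall z, K z -> ~ S z -> Cmod (f z) <= m) -> K z0 -> Cmod (f z0) <= m.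
Proof.
  intros HB Hcl Hc HS Hm Hbd Hz0. apply Rnot_lt_le. intros Hlt.
  assert (HB0 : 0 <= B) by (specialize (HB _ Hz0); assert (H := Cmod_ge_0 z0); lra).
  (* Small enough that [m ^ 2 + e * B ^ 2] stays below [Cmod (f z0) ^ 2], which forces the maximum
     of the perturbed function into [S]. *)
  set (e := (Cmod (f z0) ^ 2 - m ^ 2) / (2 * (B ^ 2 + 1))).
  assert (HB2 := pow2_ge_0 B).
  assert (Hsq : m ^ 2 < Cmod (f z0) ^ 2) by nra.
  assert (He : 0 < e) by (apply Rdiv_lt_0_compat; lra).
  assert (HeB : e * B ^ 2 < Cmod (f z0) ^ 2 - m ^ 2).
  { assert (e * (2 * (B ^ 2 + 1)) = Cmod (f z0) ^ 2 - m ^ 2) by (unfold e; field; lra). nra. }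
  destruct (compact_max K (fun z => Cmod (f z) ^ 2 + e * Cmod z ^ 2) B z0 Hz0 HB Hcl)
    as (p & Kp & Hp).
  { intros z Kz eps Heps.
    assert (H1 := Cmod_ge_0 (f z)).
    set (d1 := Rmin 1 (eps / (2 * (2 * Cmod (f z) + 1)))).
    assert (Hd1 : 0 < d1) by (apply Rmin_pos; [lra|apply Rdiv_lt_0_compat; lra]).
    destruct (Hc z Kz d1 Hd1) as (d & Hd & Hw).
    set (d2 := eps / (2 * e * (2 * B + 1))).
    assert (Hd2 : 0 < d2) by (apply Rdiv_lt_0_compat; nra).
    exists (Rmin d d2). split; [now apply Rmin_pos|]. intros w Kw Hwz.
    specialize (Hw w Kw (Rlt_le_trans _ _ _ Hwz (Rmin_l _ _))).
    assert (Hwz2 := Rlt_le_trans _ _ _ Hwz (Rmin_r _ _)).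
    assert (A1 := Cmod_le_add_sub (f w) (f z)). assert (A2 := Cmod_le_add_sub w z).
    assert (A3 := Cmod_ge_0 (f w)). assert (A4 := Cmod_ge_0 w). assert (A5 := Cmod_ge_0 z).
    assert (A6 := HB w Kw). assert (A7 := HB z Kz).
    assert (D1 : d1 <= 1) by apply Rmin_l.
    assert (D2 : d1 * (2 * Cmod (f z) + 1) <= eps / 2).
    { apply Rle_trans with (eps / (2 * (2 * Cmod (f z) + 1)) * (2 * Cmod (f z) + 1)).
      - apply Rmult_le_compat_r; [lra|apply Rmin_r].
      - right. field. lra. }
    assert (B1 : Cmod (f w) ^ 2 < Cmod (f z) ^ 2 + eps / 2) by nra.
    assert (D3 : d2 * (e * (2 * B + 1)) = eps / 2) by (unfold d2; field; lra).
    assert (B2 : e * Cmod w ^ 2 <= e * Cmod z ^ 2 + eps / 2).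
    { rewrite <- D3. assert (Cmod w ^ 2 <= Cmod z ^ 2 + d2 * (2 * B + 1)) by nra. nra. }
    lra. }
  assert (Hp0 := Hp z0 Hz0).
  assert (Sp : S p).
  { apply NNPP. intros Hn. assert (H1 := Hbd p Kp Hn). assert (H2 := HB p Kp).
    assert (H3 := Cmod_ge_0 (f p)). assert (H4 := Cmod_ge_0 p).
    assert (Cmod (f p) ^ 2 <= m ^ 2) by nra. assert (Cmod p ^ 2 <= B ^ 2) by nra.
    assert (H5 := pow2_ge_0 (Cmod z0)). nra. }
  destruct (HS p Sp) as (r & Hr & HrK & Hrf).
  set (h := fun z => (Cconj (f p) * f z + (RtoC e * Cconj p) * z)%C).
  assert (Hfst : forall z, fst (h z) = Cdot (f p) (f z) + e * Cdot p z).
  { intros z. unfold h, Cdot. simpl. ring. }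
  assert (Hcp : cont_at (fun _ => True) f p).
  { intros eps Heps. destruct (Hc p Kp eps Heps) as (d & Hd & Hw).
    exists (Rmin d r). split; [now apply Rmin_pos|]. intros w _ Hwp.
    apply Hw; [apply HrK|]; eapply Rlt_le_trans; try exact Hwp; [apply Rmin_r|apply Rmin_l]. }
  (* The depth of the peak on the circle of radius [r / 2]: it is [e / 2] times the quadratic term
     of [Cmod_sqr_shift]. *)
  assert (Hfin : e * (r / 2) ^ 2 / 2 <= 0).
  2:{ assert (0 < (r / 2) ^ 2) by (apply pow_lt; lra). nra. }
  apply (mean_value_no_peak h p r (r / 2)); [lra| | |].
  - apply cont_at_plus; apply cont_at_mult; try apply cont_at_const; [exact Hcp|].
    apply (cder_cont_at _ _ 1), cder_id.
  - intros z Hz. destruct (Hrf z Hz) as [l Hl]. eexists. unfold h.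
    apply cder_plus.
    + apply (cder_mult (fun _ => Cconj (f p)) f); [apply cder_const|exact Hl].
    + apply (cder_mult (fun _ => RtoC e * Cconj p)%C (fun z => z)); [apply cder_const|apply cder_id].
  - intros z Hz. rewrite !Hfst.
    assert (Kz : K z) by (apply HrK; lra). specialize (Hp z Kz). simpl in Hp.
    assert (H1 := Cdot_le (f p) (f z)). assert (H2 := Cmod_sqr_shift p z). rewrite Hz in H2.
    assert (E1 : Cdot (f p) (f p) = Cmod (f p) ^ 2) by (rewrite Cmod_sqr; unfold Cdot; ring).
    assert (E2 : Cdot p z = Cdot p p + Cdot p (z - p)) by (unfold Cdot; simpl; ring).
    rewrite E2, E1. simpl in *. nra.
Qed.

Lemma open_Cmod_gt (c : C) (r : R) : is_open (fun z => r < Cmod (z - c)).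
Proof.
  intros z Hz. exists (Cmod (z - c) - r). split; [lra|]. intros w Hw.
  assert (H := Cmod_sub_triangle z w c). rewrite (Cmod_sub_comm z w) in H. lra.
Qed.

Lemma open_Cmod_lt (c : C) (r : R) : is_open (fun z => Cmod (z - c) < r).
Proof.
  intros z Hz. exists (r - Cmod (z - c)). split; [lra|]. intros w Hw.
  assert (H := Cmod_sub_triangle w z c). lra.
Qed.

Lemma Cmod_sub_pos (z w : C) : z <> w -> 0 < Cmod (z - w).
Proof.
  intros H. apply Cmod_gt_0. intros E. apply H.
  replace z with (z - w + w)%C by ring. rewrite E. ring.
Qed.

Lemma cder_Cinv (z : C) : z <> 0 -> exists l, cder Cinv z l.
Proof.
  intros Hz. exists (- / (z * z))%C. intros eps He.
  assert (Hm : 0 < Cmod z) by now apply Cmod_gt_0.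
  set (d := Rmin (Cmod z / 2) (eps * (Cmod z) ^ 3 / 2)).
  exists d. split.
  { apply Rmin_pos; [lra|]. assert (0 < Cmod z ^ 3) by now apply pow_lt. nra. }
  intros w Hw.
  assert (H1 := Rlt_le_trans _ _ _ Hw (Rmin_l _ _)).
  assert (H2 := Rlt_le_trans _ _ _ Hw (Rmin_r _ _)).
  assert (H3 := Cmod_le_add_sub z w). rewrite (Cmod_sub_comm z w) in H3.
  assert (Hmw : Cmod z / 2 < Cmod w) by lra.
  assert (Hw0 : w <> 0) by (apply Cmod_gt_0; lra).
  replace (/ w - / z - - / (z * z) * (w - z))%C with ((w - z) * (w - z) / (w * z * z))%C
    by (field; auto).
  rewrite Cmod_div by (repeat apply Cmult_neq_0; auto). rewrite !Cmod_mult.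
  set (x := Cmod (w - z)) in *. assert (Hx : 0 <= x) by apply Cmod_ge_0.
  apply Rle_div_l; [repeat apply Rmult_lt_0_compat; lra|].
  assert (x <= eps * (Cmod w * Cmod z * Cmod z)).
  { assert (eps * (Cmod z ^ 3 / 2) <= eps * (Cmod w * Cmod z * Cmod z)).
    { apply Rmult_le_compat_l; [lra|]. simpl. nra. }
    lra. }
  nra.
Qed.

(* The difference quotient has an exceptional point at the centre, where it is only
   known to be continuous. *)
Lemma schwarz_bound (g : C -> C) (w z l : C) (r eps : R) :
  0 < r -> (forall z, Cmod (z - w) < 2 * r -> exists l, cder g z l) -> cder g w l ->
  (forall z, Cmod (z - w) <= r -> Cmod (g z) <= eps) -> Cmod (z - w) <= r ->
  Cmod (g z - g w) <= 2 * eps / r * Cmod (z - w) /\ Cmod l <= 2 * eps / r.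
Proof.
  intros Hr Hg Hl Hb Hz.
  assert (Heps : 0 <= eps).
  { eapply Rle_trans; [apply Cmod_ge_0|apply (Hb w)]. rewrite Cmod_sub_self. lra. }
  set (Q := fun z => if excluded_middle_informative (z = w) then l else ((g z - g w) / (z - w))%C).
  assert (Qw : Q w = l) by (unfold Q; destruct excluded_middle_informative; tauto).
  assert (Qz : forall z, z <> w -> Q z = ((g z - g w) / (z - w))%C).
  { intros z' Hz'. unfold Q. destruct excluded_middle_informative; tauto. }
  assert (HQd : forall z, 0 < Cmod (z - w) < 2 * r -> exists l, cder Q z l).
  { intros z' [Hz' Hz2]. destruct (Hg z' Hz2) as [l' Hl'].
    destruct (cder_Cinv (z' - w)%C) as [m Hm]; [now apply Cmod_gt_0|].
    eexists. apply cder_ext_loc with (f := fun z => ((g z - g w) * / (z - w))%C) (r := Cmod (z' - w)).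
    - exact Hz'.
    - intros u Hu. symmetry. apply Qz. intros ->. rewrite Cmod_sub_comm in Hu. lra.
    - apply (cder_mult (fun z => g z - g w)%C (fun z => / (z - w))%C).
      + apply cder_minus; [exact Hl'|apply cder_const].
      + apply (cder_comp Cinv (fun z => z - w)%C); [exact Hm|].
        apply cder_minus; [apply cder_id|apply cder_const]. }
  assert (HQ : forall z, Cmod (z - w) <= r -> Cmod (Q z) <= 2 * eps / r).
  { intros z' Hz'.
    apply (max_principle (fun z => Cmod (z - w) <= r) (fun z => Cmod (z - w) < r) Q (Cmod w + r)).
    - intros u Hu. assert (H := Cmod_le_add_sub u w). lra.
    - intros u Hu. destruct (open_Cmod_gt w r u) as (d & Hd & H); [lra|].
      exists d. split; [exact Hd|]. intros v Hv. specialize (H v Hv). lra.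
    - intros u Hu. destruct (classic (u = w)) as [->|Huw].
      + intros e He. destruct (Hl (e / 2)) as (d & Hd & H); [lra|]. exists d. split; [exact Hd|].
        intros v _ Hv. rewrite Qw. destruct (classic (v = w)) as [->|Hvw].
        * rewrite Qw, Cmod_sub_self. exact He.
        * rewrite Qz by exact Hvw. specialize (H v Hv). assert (Hp := Cmod_sub_pos v w Hvw).
          assert (Hne : (v - w)%C <> 0) by (now apply Cmod_gt_0).
          replace ((g v - g w) / (v - w) - l)%C with ((g v - g w - l * (v - w)) / (v - w))%C
            by (field; exact Hne).
          rewrite Cmod_div by exact Hne. apply Rle_lt_trans with (e / 2); [|lra].
          apply Rle_div_l; [exact Hp|exact H].
      + destruct (HQd u) as [l' Hl']; [split; [now apply Cmod_sub_pos|lra]|].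
        now apply (cder_cont_at _ _ l').
    - intros p Hp.
      (* The exceptional point [w] may lie in the disk around [p] only as its centre. *)
      assert (Hd : exists d, 0 < d <= r - Cmod (p - w) /\ (p = w \/ d <= Cmod (p - w))).
      { destruct (classic (p = w)) as [->|Hpw].
        - exists r. rewrite Cmod_sub_self. split; [lra|now left].
        - exists (Rmin (r - Cmod (p - w)) (Cmod (p - w))). split; [split|right; apply Rmin_r].
          + apply Rmin_pos; [lra|now apply Cmod_sub_pos].
          + apply Rmin_l. }
      destruct Hd as (d & [Hd Hdr] & Hdw). exists d. split; [exact Hd|]. split; intros u Hu;
        assert (H := Cmod_sub_triangle u p w); [lra|].
      apply HQd. split; [|lra]. destruct Hdw as [<-|Hdw]; [tauto|].
      apply Cmod_sub_pos. intros ->. rewrite Cmod_sub_comm in Hu. lra.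
    - apply Rmult_le_pos; [lra|]. left. now apply Rinv_0_lt_compat.
    - intros u Hu Hu'. assert (E : Cmod (u - w) = r) by lra.
      assert (Huw : u <> w) by (intros ->; rewrite Cmod_sub_self in E; lra).
      rewrite Qz by exact Huw. rewrite Cmod_div by (apply Cmod_gt_0; lra). rewrite E.
      apply Rmult_le_compat_r; [left; now apply Rinv_0_lt_compat|].
      assert (H := Cmod_triangle (g u) (- g w)). rewrite Cmod_opp in H.
      assert (H1 := Hb u Hu). assert (H2 := Hb w ltac:(rewrite Cmod_sub_self; lra)).
      unfold Cminus. lra.
    - exact Hz'. }
  split.
  - destruct (classic (z = w)) as [->|Hzw].
    + rewrite !Cmod_sub_self. lra.
    + specialize (HQ z Hz). rewrite Qz in HQ by exact Hzw.
      assert (Hp := Cmod_sub_pos z w Hzw).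
      rewrite Cmod_div in HQ by (now apply Cmod_gt_0). apply (Rle_div_l _ _ _ Hp). exact HQ.
  - rewrite <- Qw. apply HQ. rewrite Cmod_sub_self. lra.
Qed.

(** * Uniform limits and the two constants theorem *)

(** Bounded from above only: in use the terms dominate moduli. *)
Definition vanishing (e : nat -> R) : Prop :=
  forall eps, 0 < eps -> exists n, forall m, (n <= m)%nat -> e m < eps.

Lemma Cmod_le_limit (x : nat -> C) (y : C) (e : nat -> R) (c : R) (i : nat) :
  vanishing e -> (forall j, (i <= j)%nat -> Cmod (x j - y) <= e j) ->
  (forall j, (i <= j)%nat -> Cmod (x j) <= c) -> Cmod y <= c.
Proof.
  intros He Hx Hc. apply Rnot_lt_le. intros Hlt.
  destruct (He (Cmod y - c)) as [n Hn]; [lra|].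
  specialize (Hn (max i n) ltac:(lia)). specialize (Hx (max i n) ltac:(lia)).
  specialize (Hc (max i n) ltac:(lia)).
  assert (H := Cmod_le_add_sub y (x (max i n))).
  rewrite (Cmod_sub_comm y) in H. lra.
Qed.

(** The rate [e] survives in the limit, so that pointwise limits of functions are uniform with the
    same rate. *)
Lemma C_complete (u : nat -> C) (e : nat -> R) : vanishing e ->
  (forall i j, (i <= j)%nat -> Cmod (u i - u j) <= e i) ->
  exists l, forall i, Cmod (u i - l) <= e i.
Proof.
  intros He Hu.
  assert (Hcv : forall (pr : C -> R), (forall z w, Rabs (pr z - pr w) <= Cmod (z - w)) ->
    exists l, Un_cv (fun n => pr (u n)) l).
  { intros pr Hpr. assert (Hcauchy : Cauchy_crit (fun n => pr (u n))).
    2:{ destruct (Rcomplete.R_complete _ Hcauchy) as [l Hl]. exists l. exact Hl. }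
    intros eps Heps. destruct (He (eps / 2)) as [n Hn]; [lra|]. exists n. intros i j Hi Hj.
    eapply Rle_lt_trans; [apply Hpr|].
    assert (H := Cmod_sub_triangle (u i) (u n) (u j)). rewrite (Cmod_sub_comm (u i) (u n)) in H.
    assert (H1 := Hu n i Hi). assert (H2 := Hu n j Hj). specialize (Hn n (le_n n)). lra. }
  destruct (Hcv fst) as [a Ha]; [intros z w; apply (fst_le_Cmod (z - w))|].
  destruct (Hcv snd) as [b Hb]; [intros z w; apply (im_le_Cmod (z - w))|].
  exists (a, b). intros i. apply Rnot_lt_le. intros Hlt.
  set (d := Cmod (u i - (a, b)) - e i) in *.
  destruct (Ha (d / 2)) as [n1 H1]; [unfold d; lra|].
  destruct (Hb (d / 2)) as [n2 H2]; [unfold d; lra|].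
  set (j := max i (max n1 n2)).
  specialize (H1 j ltac:(unfold j; lia)). specialize (H2 j ltac:(unfold j; lia)).
  unfold Rdist in *. assert (H3 := Cmod_le_sum (u j - (a, b))). simpl in H3.
  change (Rabs (fst (u j) - a) < d / 2) in H1. change (Rabs (snd (u j) - b) < d / 2) in H2.
  unfold Rminus in H1, H2. assert (H4 := Hu i j ltac:(unfold j; lia)).
  assert (H5 := Cmod_sub_triangle (u i) (u j) (a, b)). unfold d in *. lra.
Qed.

Lemma vanishing_scal (e : nat -> R) (c : R) : 0 <= c -> vanishing e -> vanishing (fun n => c * e n).
Proof.
  intros Hc He eps Heps. destruct (He (eps / (c + 1))) as [n Hn]; [apply Rdiv_lt_0_compat; lra|].
  exists n. intros m Hm. specialize (Hn m Hm).
  apply (Rmult_lt_compat_l (c + 1)) in Hn; [|lra].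
  replace ((c + 1) * (eps / (c + 1))) with eps in Hn by (field; lra).
  destruct (Rle_dec 0 (e m)); nra.
Qed.

(** The Schwarz bound for [f i - f j] shows that both the derivatives at [w] and the difference
    quotients based at [w] are Cauchy at the rate [2 / r * e i]. The remainder of [g] is then that
    of one [f i] plus two errors of this size. *)
Lemma weierstrass (S : C -> Prop) (f : nat -> C -> C) (g : C -> C) (e : nat -> R) :
  is_open S -> vanishing e ->
  (forall i z, S z -> exists l, cder (f i) z l) ->
  (forall i j z, (i <= j)%nat -> S z -> Cmod (f i z - f j z) <= e i) ->
  (forall i z, S z -> Cmod (f i z - g z) <= e i) ->
  forall w, S w -> exists l, cder g w l.
Proof.
  intros HS He Hf Hij Hg w Sw.
  destruct (HS w Sw) as (r2 & Hr2 & HrS). set (r := r2 / 2). assert (Hr : 0 < r) by (unfold r; lra).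
  set (l := fun i => proj1_sig (constructive_indefinite_description _ (Hf i w Sw))).
  assert (Hl : forall i, cder (f i) w (l i)).
  { intros i. unfold l. destruct constructive_indefinite_description. assumption. }
  assert (Hsch : forall i j z, (i <= j)%nat -> Cmod (z - w) <= r ->
    Cmod ((f i z - f j z) - (f i w - f j w)) <= 2 / r * e i * Cmod (z - w) /\
    Cmod (l i - l j) <= 2 / r * e i).
  { intros i j z Hle Hz. replace (2 / r * e i) with (2 * e i / r) by (field; lra).
    apply (schwarz_bound (fun z => f i z - f j z)%C w z (l i - l j) r (e i)); auto.
    - intros u Hu. assert (Su : S u) by (apply HrS; unfold r in *; lra).
      destruct (Hf i u Su) as [a Ha], (Hf j u Su) as [b Hb]. exists (a - b)%C. apply cder_minus; assumption.
    - now apply cder_minus.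
    - intros u Hu. apply Hij; [exact Hle|]. apply HrS. unfold r in *; lra. }
  assert (H2r : 0 < 2 / r) by (apply Rdiv_lt_0_compat; lra).
  destruct (C_complete l (fun i => 2 / r * e i)) as [L HL].
  { apply vanishing_scal; [lra|exact He]. }
  { intros i j Hle. apply (Hsch i j w Hle). rewrite Cmod_sub_self. lra. }
  exists L. intros eps Heps.
  destruct (vanishing_scal e (2 / r) ltac:(lra) He (eps / 4)) as [i Hi]; [lra|].
  specialize (Hi i (le_n i)).
  destruct (Hl i (eps / 4)) as (d & Hd & Hw); [lra|].
  exists (Rmin d r). split; [now apply Rmin_pos|]. intros z Hz.
  specialize (Hw z (Rlt_le_trans _ _ _ Hz (Rmin_l _ _))).
  assert (Hzr := Rlt_le_trans _ _ _ Hz (Rmin_r _ _)).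
  assert (Sz : S z) by (apply HrS; unfold r in *; lra).
  assert (Hlim : Cmod ((f i z - g z) - (f i w - g w)) <= 2 / r * e i * Cmod (z - w)).
  { apply (Cmod_le_limit (fun j => (f i z - f j z) - (f i w - f j w))%C _ (fun j => 2 * e j) _ i).
    - apply vanishing_scal; [lra|exact He].
    - intros j Hj.
      replace (f i z - f j z - (f i w - f j w) - (f i z - g z - (f i w - g w)))%C
        with ((f j w - g w) + - (f j z - g z))%C by ring.
      eapply Rle_trans; [apply Cmod_triangle|]. rewrite Cmod_opp.
      assert (H1 := Hg j z Sz). assert (H2 := Hg j w Sw). lra.
    - intros j Hj. apply Hsch; [exact Hj|lra]. }
  replace (g z - g w - L * (z - w))%C with
    ((f i z - f i w - l i * (z - w)) +
      (- ((f i z - g z) - (f i w - g w)) + (l i - L) * (z - w)))%C by ring.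
  eapply Rle_trans; [apply Cmod_triangle|].
  assert (T := Cmod_triangle (- ((f i z - g z) - (f i w - g w))) ((l i - L) * (z - w))).
  rewrite Cmod_opp, Cmod_mult in T. specialize (HL i).
  assert (H0 := Cmod_ge_0 (z - w)).
  assert (2 / r * e i * Cmod (z - w) <= eps / 4 * Cmod (z - w)) by (apply Rmult_le_compat_r; lra).
  assert (Cmod (l i - L) * Cmod (z - w) <= eps / 4 * Cmod (z - w)) by (apply Rmult_le_compat_r; lra).
  nra.
Qed.

(** * One-sided regularity and the two constants theorem *)

Definition disk_part (A : C -> Prop) (z0 : C) (r : R) (z : C) : Prop :=
  Cmod (z - z0) < r /\ A z.

(** The parameters let one argument treat U2, U3 and U5: the pair [cl], [op] will be the closed and
    open outside, the closed and open inside, or twice the whole plane. *)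
Definition regular (cl op : C -> Prop) (z0 : C) (r : R) (G : C -> C) : Prop :=
  (forall z, disk_part cl z0 r z -> cont_at (disk_part cl z0 r) G z) /\
  forall z, disk_part op z0 r z -> exists l, cder G z l.

Definition unit_circle (z : C) : Prop := Cmod z = 1.
Definition cl_in (z : C) : Prop := Cmod z <= 1.
Definition op_in (z : C) : Prop := Cmod z < 1.
Definition cl_out (z : C) : Prop := 1 <= Cmod z.
Definition op_out (z : C) : Prop := 1 < Cmod z.

(** Interpolation between [M] and [eps] with exponent 1/2, which shrinking the disk makes available.
    [rho] is chosen before [G], so one radius serves a whole family of functions. *)
Definition two_constants (cl op : C -> Prop) : Prop :=
  forall z0 r, unit_circle z0 -> 0 < r -> exists rho, 0 < rho <= r /\
    forall G M eps, regular cl op z0 r G -> 0 < eps <= M ->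
      (forall z, disk_part cl z0 r z -> Cmod (G z) <= M) ->
      (forall z, disk_part unit_circle z0 r z -> Cmod (G z) <= eps) ->
      forall z, disk_part cl z0 rho z -> Cmod (G z) ^ 2 <= M * eps.

(** Expand [Cmod z ^ 2] around [z0]. Over the closed disk the linear form reaches 0 at [z0] only,
    which is what makes it a barrier. *)
Lemma Cdot_sub_unit (z0 z : C) : unit_circle z0 -> cl_in z ->
  2 * Cdot z0 (z - z0) <= - Cmod (z - z0) ^ 2.
Proof.
  intros H0 Hz. assert (H := Cmod_sqr_shift z0 z). rewrite H0 in H.
  assert (H1 := Cmod_ge_0 z). unfold cl_in in Hz.
  assert (Cmod z ^ 2 <= 1) by nra. lra.
Qed.

Lemma Cdot_ge (z0 z : C) : unit_circle z0 -> - Cmod z <= Cdot z0 z.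
Proof.
  intros H0. assert (E : Cdot z0 z = fst (Cconj z0 * z)%C) by (unfold Cdot; simpl; ring).
  rewrite E. assert (H := fst_le_Cmod (Cconj z0 * z)).
  rewrite Cmod_mult, Cmod_conj, H0, Rmult_1_l in H. apply Rabs_le_between in H. lra.
Qed.

(* The barrier [1 + 2 / r1^2 * Re (conj z0 * (z - z0))] is at most 1 on the arc, at most 0 on
   the rest of the boundary of the lens [|z| <= 1, |z - z0| <= r1], and at least 1/2 near z0. *)
Lemma two_constants_in : two_constants cl_in op_in.
Proof.
  intros z0 r H0 Hr. set (r1 := r / 2). assert (Hr1 : 0 < r1) by (unfold r1; lra).
  (* On [Cmod (z - z0) = r1] the barrier is then at most [1 - c * r1 ^ 2 / 2 = 0]. *)
  set (c := 2 / r1 ^ 2).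
  assert (Hr12 : 0 < r1 ^ 2) by now apply pow_lt.
  assert (Hc : 0 < c) by (apply Rdiv_lt_0_compat; lra).
  assert (Hcr : c * r1 ^ 2 = 2) by (unfold c; field; lra).
  (* Since [c * (r1 ^ 2 / 4) = 1 / 2], the barrier is at least 1/2 within this radius. *)
  exists (Rmin r1 (r1 ^ 2 / 4)). split.
  { split; [apply Rmin_pos; lra|]. apply Rle_trans with (1 := Rmin_l _ _). unfold r1; lra. }
  intros G M eps [Gc Gd] [He HM] HbM Hbe z [Hz Hcz].
  assert (Hz1 := Rlt_le_trans _ _ _ Hz (Rmin_l _ _)).
  assert (Hz2 := Rlt_le_trans _ _ _ Hz (Rmin_r _ _)).
  (* [exp L] raises [eps] to [M]: multiplied by the exponential of [L] times the barrier, [G] has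
     the single bound [M] on the whole boundary of the lens. *)
  set (L := ln (M / eps)).
  assert (HL : 0 <= L).
  { unfold L. rewrite <- ln_1. apply ln_le; [lra|]. apply Rle_div_r; lra. }
  assert (HeL : exp L = M / eps) by (apply exp_ln, Rdiv_lt_0_compat; lra).
  set (q := fun z => (RtoC L * (1 + RtoC c * (Cconj z0 * (z - z0))))%C).
  set (f := fun z => (G z * cexp (q z))%C).
  assert (Hf : forall z, Cmod (f z) = Cmod (G z) * exp (L * (1 + c * Cdot z0 (z - z0)))).
  { intros u. unfold f. rewrite Cmod_mult, Cmod_cexp. do 2 f_equal.
    unfold q, Cdot. simpl. ring. }
  assert (Hq : forall z, exists l, cder (fun z => cexp (q z)) z l).
  { intros u. eexists. apply (cder_comp cexp q); [apply cder_cexp|].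
    apply (cder_mult (fun _ => RtoC L)); [apply cder_const|].
    apply (cder_plus (fun _ => RtoC 1)); [apply cder_const|].
    apply (cder_mult (fun _ => RtoC c)); [apply cder_const|].
    apply (cder_mult (fun _ => Cconj z0)); [apply cder_const|].
    apply (cder_minus (fun z => z)); [apply cder_id|apply cder_const]. }
  assert (Hmax : Cmod (f z) <= M).
  { apply (max_principle (fun z => cl_in z /\ Cmod (z - z0) <= r1)
      (fun z => op_in z /\ Cmod (z - z0) < r1) f 1); unfold cl_in, op_in in *.
    - tauto.
    - intros u Hu. destruct (Rle_dec (Cmod u) 1) as [H|H].
      + destruct (open_Cmod_gt z0 r1 u) as (d & Hd & Hv); [tauto || (apply Rnot_le_lt; tauto)|].
        exists d. split; [exact Hd|]. intros v Hvu [_ Hv']. specialize (Hv v Hvu). lra.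
      + destruct (open_Cmod_gt 0 1 u) as (d & Hd & Hv).
        { unfold Cminus. rewrite Copp_0, Cplus_0_r. lra. }
        exists d. split; [exact Hd|]. intros v Hvu [Hv' _]. specialize (Hv v Hvu).
        unfold Cminus in Hv. rewrite Copp_0, Cplus_0_r in Hv. lra.
    - intros u [Hu1 Hu2]. destruct (Hq u) as [l Hl].
      apply cont_at_mult; [|now apply (cder_cont_at _ _ l)].
      apply (cont_at_sub (disk_part cl_in z0 r)).
      + intros w [Hw1 Hw2]. split; [unfold r1 in *; lra|exact Hw1].
      + apply Gc. split; [unfold r1 in *; lra|exact Hu1].
    - intros p [Hp1 Hp2].
      exists (Rmin (1 - Cmod p) (r1 - Cmod (p - z0))). split; [apply Rmin_pos; lra|].
      assert (Hin : forall u, Cmod (u - p) < Rmin (1 - Cmod p) (r1 - Cmod (p - z0)) ->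
        Cmod u < 1 /\ Cmod (u - z0) < r1).
      { intros u Hu. assert (A1 := Rlt_le_trans _ _ _ Hu (Rmin_l _ _)).
        assert (A2 := Rlt_le_trans _ _ _ Hu (Rmin_r _ _)).
        assert (A3 := Cmod_le_add_sub u p). assert (A4 := Cmod_sub_triangle u p z0). lra. }
      split.
      + intros u Hu. destruct (Hin u Hu). lra.
      + intros u [_ Hu]. destruct (Hin u Hu) as [H1 H2].
        destruct (Gd u) as [l Hl]; [split; [unfold r1 in *; lra|exact H1]|].
        destruct (Hq u) as [l' Hl']. eexists. apply (cder_mult G _ u l l'); assumption.
    - lra.
    - intros u [Hu1 Hu2] Hn. rewrite Hf.
      assert (Hdot := Cdot_sub_unit z0 u H0 Hu1). assert (H2 := pow2_ge_0 (Cmod (u - z0))).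
      assert (Hu0 := Cmod_ge_0 (G u)).
      assert (HGM : Cmod (G u) <= M) by (apply HbM; split; [unfold r1 in *; lra|exact Hu1]).
      destruct (Req_dec (Cmod u) 1) as [E|E].
      + assert (HGe : Cmod (G u) <= eps) by (apply Hbe; split; [unfold r1 in *; lra|exact E]).
        replace M with (eps * exp L) by (rewrite HeL; field; lra).
        apply Rmult_le_compat; [exact Hu0|left; apply exp_pos|exact HGe|].
        apply exp_le_compat. rewrite <- (Rmult_1_r L) at 2. apply Rmult_le_compat_l; [exact HL|].
        nra.
      + assert (E2 : Cmod (u - z0) = r1).
        { apply Rle_antisym; [exact Hu2|]. apply Rnot_lt_le. intros H. apply Hn. split; lra. }
        rewrite E2 in Hdot. rewrite <- (Rmult_1_r M).
        apply Rmult_le_compat; [exact Hu0|left; apply exp_pos|exact HGM|].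
        apply Rle_trans with (exp 0); [apply exp_le_compat|rewrite exp_0; lra].
        assert (Hc1 : c * (2 * Cdot z0 (u - z0)) <= c * - r1 ^ 2) by (apply Rmult_le_compat_l; lra).
        assert (0 <= L * - (1 + c * Cdot z0 (u - z0))) by (apply Rmult_le_pos; lra). lra.
    - split; [exact Hcz|lra]. }
  rewrite Hf in Hmax.
  assert (Hhalf : exp (L / 2) <= exp (L * (1 + c * Cdot z0 (z - z0)))).
  { apply exp_le_compat. assert (H := Cdot_ge z0 (z - z0) H0).
    assert (Hc1 : c * - (r1 ^ 2 / 4) <= c * Cdot z0 (z - z0)) by (apply Rmult_le_compat_l; lra).
    assert (0 <= L * (1 / 2 + c * Cdot z0 (z - z0))) by (apply Rmult_le_pos; lra). lra. }
  assert (HG0 := Cmod_ge_0 (G z)). assert (HE0 := exp_pos (L / 2)).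
  assert (HGE : Cmod (G z) * exp (L / 2) <= M) by nra.
  assert (HEE : exp (L / 2) * exp (L / 2) = M / eps).
  { rewrite <- exp_plus, <- HeL. f_equal. field. }
  assert (Hsq : Cmod (G z) ^ 2 * (M / eps) <= M ^ 2).
  { rewrite <- HEE. assert (0 <= Cmod (G z) * exp (L / 2)) by nra. nra. }
  apply (Rmult_le_reg_r (M / eps)); [apply Rdiv_lt_0_compat; lra|].
  replace (M * eps * (M / eps)) with (M ^ 2) by (field; lra). exact Hsq.
Qed.

(** * Reflection in the unit circle *)

Definition inversion (z : C) : C := (/ Cconj z)%C.

Lemma inversion_conj (z : C) : z <> 0 -> inversion z = Cconj (/ z).
Proof. intros Hz. unfold inversion. symmetry. now apply Cinv_conj. Qed.

Lemma Cconj_neq_0 (z : C) : z <> 0 -> Cconj z <> 0.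
Proof. intros Hz. apply Cmod_gt_0. rewrite Cmod_conj. now apply Cmod_gt_0. Qed.

Lemma Cmod_inversion (z : C) : z <> 0 -> Cmod (inversion z) = / Cmod z.
Proof. intros Hz. unfold inversion. rewrite Cmod_inv, Cmod_conj; [reflexivity|now apply Cconj_neq_0]. Qed.

(** A consequence of [z0 * Cconj z0 = 1]. Within distance 1/2 of [z0] the factor [1 / Cmod z] is at
    most 2, whence the radii [r / 2] and [1 / 2] below. *)
Lemma Cmod_inversion_sub (z0 z : C) : unit_circle z0 -> z <> 0 ->
  Cmod (inversion z - z0) = Cmod (z - z0) / Cmod z.
Proof.
  intros H0 Hz. assert (Hc := Cconj_neq_0 z Hz).
  assert (E : (z0 * Cconj z0)%C = 1) by (rewrite <- Cmod2_conj, H0, RtoC_pow; ring).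
  replace (inversion z - z0)%C with (z0 * (Cconj z0 - Cconj z) / Cconj z)%C.
  - rewrite Cmod_div, Cmod_mult, H0, Rmult_1_l, Cmod_conj by exact Hc.
    rewrite <- Cminus_conj, Cmod_conj, Cmod_sub_comm. reflexivity.
  - replace (z0 * (Cconj z0 - Cconj z))%C with (z0 * Cconj z0 - z0 * Cconj z)%C by ring.
    rewrite E. unfold inversion. field. exact Hc.
Qed.

Lemma inversion_involutive (z : C) : z <> 0 -> inversion (inversion z) = z.
Proof.
  intros Hz. rewrite (inversion_conj z Hz). unfold inversion. rewrite Cconj_conj. field. exact Hz.
Qed.

Lemma inversion_unit (z : C) : unit_circle z -> inversion z = z.
Proof.
  intros H0. assert (E : (z * Cconj z)%C = 1) by (rewrite <- Cmod2_conj, H0, RtoC_pow; ring).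
  assert (Hz : z <> 0) by (apply Cmod_gt_0; rewrite H0; lra).
  assert (Hc := Cconj_neq_0 z Hz). unfold inversion.
  rewrite <- (Cmult_1_l (/ Cconj z)), <- E. field. exact Hc.
Qed.

Definition schwarz_reflect (G : C -> C) (z : C) : C := Cconj (G (inversion z)).

(** The reflected function is the composition of [Cinv] with [Cconj (G (Cconj u))], whose derivative
    is the conjugate of that of [G]: the two conjugations cancel. *)
Lemma reflect_regular (z0 : C) (r s : R) (G : C -> C) : unit_circle z0 ->
  s <= r / 2 -> s <= 1 / 2 -> regular cl_out op_out z0 r G ->
  regular cl_in op_in z0 s (schwarz_reflect G).
Proof.
  intros H0 Hs1 Hs2 [Gc Gd].
  assert (Hdom : forall z, Cmod (z - z0) < s -> z <> 0 /\ Cmod (inversion z - z0) < r).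
  { intros z Hz. assert (H1 := Cmod_le_add_sub z0 z). rewrite H0, Cmod_sub_comm in H1.
    assert (Hz0 : z <> 0) by (apply Cmod_gt_0; lra). split; [exact Hz0|].
    rewrite Cmod_inversion_sub by assumption. apply Rlt_div_l; [lra|].
    assert (H2 := Cmod_ge_0 (z - z0)). nra. }
  split.
  - intros z [Hz Hz1]. destruct (Hdom z Hz) as [Hn Hr]. intros eps He.
    assert (Hiv : disk_part cl_out z0 r (inversion z)).
    { split; [exact Hr|]. unfold cl_out, cl_in in *. rewrite Cmod_inversion by exact Hn.
      rewrite <- Rinv_1. apply Rinv_le_contravar; [now apply Cmod_gt_0|exact Hz1]. }
    destruct (Gc _ Hiv eps He) as (d & Hd & Hw).
    destruct (cder_Cinv z Hn) as [l Hl].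
    destruct (cder_cont_at _ _ _ (fun _ => True) Hl d Hd) as (d' & Hd' & Hw').
    exists d'. split; [exact Hd'|]. intros w [Hw1 Hw2] Hwz.
    destruct (Hdom w Hw1) as [Hwn Hwr]. unfold schwarz_reflect.
    rewrite <- Cminus_conj, Cmod_conj. apply Hw.
    + split; [exact Hwr|]. unfold cl_out, cl_in in *. rewrite Cmod_inversion by exact Hwn.
      rewrite <- Rinv_1. apply Rinv_le_contravar; [now apply Cmod_gt_0|exact Hw2].
    + rewrite !inversion_conj by assumption. rewrite <- Cminus_conj, Cmod_conj. now apply Hw'.
  - intros z [Hz Hz1]. destruct (Hdom z Hz) as [Hn Hr].
    assert (Hiv : disk_part op_out z0 r (inversion z)).
    { split; [exact Hr|]. unfold op_out, op_in in *. rewrite Cmod_inversion by exact Hn.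
      rewrite <- Rinv_1. apply Rinv_lt_contravar; [|exact Hz1].
      rewrite Rmult_1_r. now apply Cmod_gt_0. }
    destruct (Gd _ Hiv) as [l Hl]. rewrite inversion_conj in Hl by exact Hn.
    destruct (cder_Cinv z Hn) as [m Hm].
    assert (Hcc : cder (fun u => Cconj (G (Cconj u))) (/ z)%C (Cconj l)).
    { intros eps He. destruct (Hl eps He) as (d & Hd & Hw). exists d. split; [exact Hd|].
      intros w Hwz. specialize (Hw (Cconj w)). rewrite <- Cminus_conj, Cmod_conj in Hw.
      specialize (Hw Hwz). rewrite <- (Cmod_conj (_ - _ - _)) in Hw.
      rewrite !Cminus_conj, Cmult_conj, !Cminus_conj, !Cconj_conj in Hw. exact Hw. }
    eexists. apply cder_ext_loc with (r := Cmod z) (f := fun z => Cconj (G (Cconj (/ z)))).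
    + now apply Cmod_gt_0.
    + intros w Hw. unfold schwarz_reflect. rewrite inversion_conj; [reflexivity|].
      intros ->. unfold Cminus in Hw. rewrite Cplus_0_l, Cmod_opp in Hw. lra.
    + apply (cder_comp (fun u => Cconj (G (Cconj u))) Cinv); eassumption.
Qed.

Lemma two_constants_out : two_constants cl_out op_out.
Proof.
  intros z0 r H0 Hr. set (s := Rmin (r / 2) (1 / 2)).
  assert (Hs : 0 < s) by (apply Rmin_pos; lra).
  assert (Hs1 : s <= r / 2) by apply Rmin_l. assert (Hs2 : s <= 1 / 2) by apply Rmin_r.
  destruct (two_constants_in z0 s H0 Hs) as (rho & [Hrho Hrs] & Htc).
  exists rho. split; [lra|]. intros G M eps HG HM HbM Hbe z [Hz Hz1].
  unfold cl_out in Hz1.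
  assert (Hn : z <> 0) by (apply Cmod_gt_0; lra).
  assert (Hdom : forall u, Cmod (u - z0) < s -> cl_in u ->
    u <> 0 /\ Cmod (inversion u - z0) < r /\ cl_out (inversion u)).
  { intros u Hu Hu1. assert (H1 := Cmod_le_add_sub z0 u). rewrite H0, Cmod_sub_comm in H1.
    assert (Hu0 : u <> 0) by (apply Cmod_gt_0; lra). split; [exact Hu0|].
    unfold cl_out, cl_in in *.
    rewrite Cmod_inversion_sub, Cmod_inversion by assumption. split.
    - apply Rlt_div_l; [lra|]. assert (H2 := Cmod_ge_0 (u - z0)). nra.
    - rewrite <- Rinv_1. apply Rinv_le_contravar; [now apply Cmod_gt_0|exact Hu1]. }
  assert (E : Cmod (schwarz_reflect G (inversion z)) = Cmod (G z)).
  { unfold schwarz_reflect. rewrite Cmod_conj, inversion_involutive by exact Hn. reflexivity. }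
  rewrite <- E. apply (Htc (schwarz_reflect G) M eps).
  - apply (reflect_regular z0 r); assumption.
  - exact HM.
  - intros u [Hu Hu1]. unfold schwarz_reflect. rewrite Cmod_conj. apply HbM.
    split; now apply Hdom.
  - intros u [Hu Hu1]. unfold schwarz_reflect. rewrite Cmod_conj, inversion_unit by exact Hu1.
    apply Hbe. split; [lra|exact Hu1].
  - split.
    (* Here [Cmod z] is at least 1, so inversion does not increase the distance to [z0] and [rho]
       can be kept. *)
    + rewrite Cmod_inversion_sub by assumption. apply Rlt_div_l; [lra|].
      assert (H := Cmod_ge_0 (z - z0)). nra.
    + unfold cl_in. rewrite Cmod_inversion by exact Hn. rewrite <- Rinv_1.
      apply Rinv_le_contravar; lra.
Qed.

Definition everywhere (_ : C) : Prop := True.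

Lemma regular_sub (cl op cl' op' : C -> Prop) (z0 z1 : C) (r s : R) (G : C -> C) :
  (forall z, disk_part cl' z1 s z -> disk_part cl z0 r z) ->
  (forall z, disk_part op' z1 s z -> disk_part op z0 r z) ->
  regular cl op z0 r G -> regular cl' op' z1 s G.
Proof.
  intros Hcl Hop [Gc Gd]. split; [|auto].
  intros z Hz. apply (cont_at_sub (disk_part cl z0 r)); auto.
Qed.

Lemma two_constants_everywhere : two_constants everywhere everywhere.
Proof.
  intros z0 r H0 Hr.
  destruct (two_constants_in z0 r H0 Hr) as (r1 & [H1 H1r] & T1).
  destruct (two_constants_out z0 r H0 Hr) as (r2 & [H2 H2r] & T2).
  assert (Hm1 := Rmin_l r1 r2). assert (Hm2 := Rmin_r r1 r2).
  exists (Rmin r1 r2). split; [split; [now apply Rmin_pos|lra]|].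
  intros G M eps HG HM HbM Hbe z [Hz _].
  assert (Hsub : forall A w, disk_part A z0 r w -> disk_part everywhere z0 r w).
  { intros A w [Hw _]. split; [exact Hw|exact I]. }
  destruct (Rle_dec (Cmod z) 1) as [Hle|Hgt].
  - apply (T1 G M eps); try assumption.
    + apply (regular_sub everywhere everywhere _ _ z0 _ r); eauto.
    + eauto.
    + split; [lra|exact Hle].
  - apply (T2 G M eps); try assumption.
    + apply (regular_sub everywhere everywhere _ _ z0 _ r); eauto.
    + eauto.
    + split; [lra|unfold cl_out; lra].
Qed.

(** * Local extensions and the G_delta property *)

Lemma expi_cexp (t : R) : expi t = cexp (0, t).
Proof. unfold expi, cexp. simpl. now rewrite exp_0, !Rmult_1_l. Qed.

Lemma expi_unit (t : R) : unit_circle (expi t).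
Proof. unfold unit_circle. rewrite expi_cexp, Cmod_cexp. apply exp_0. Qed.

Lemma onT_unit (z : C) : onT z <-> unit_circle z.
Proof. unfold onT, unit_circle. now rewrite Cnorm_Cmod. Qed.

(** A nonnegative angle can be approximated by the fractions of natural numbers in [grid_point]. *)
Lemma unit_expi (z : C) : unit_circle z -> exists t, 0 <= t /\ z = expi t.
Proof.
  intros Hz. assert (H2 := Cmod_sqr z). rewrite Hz in H2. destruct z as [x y]. simpl in H2.
  assert (Hx : -1 <= x <= 1) by nra.
  assert (Hb := acos_bound x). assert (Hc := cos_acos x Hx). assert (Hs := sin_acos x Hx).
  assert (Ey : y * y = 1 - x²) by (unfold Rsqr; lra).
  destruct (Rle_dec 0 y) as [Hy|Hy].
  - exists (acos x). split; [lra|]. unfold expi. rewrite Hc, Hs, <- Ey, sqrt_square by exact Hy.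
    reflexivity.
  - exists (2 * PI - acos x). split; [lra|]. unfold expi. rewrite cos_minus, sin_minus.
    rewrite cos_2PI, sin_2PI, Hc, Hs, <- Ey. replace (y * y) with (- y * - y) by ring.
    rewrite sqrt_square by lra. f_equal; ring.
Qed.

Lemma expi_continuous (t eps : R) : 0 < eps ->
  exists delta, 0 < delta /\ forall s, Rabs (s - t) < delta -> Cmod (expi s - expi t) < eps.
Proof.
  intros He.
  destruct (cder_cont_at _ _ _ (fun _ => True) (cder_cexp (0, t)) eps He) as (d & Hd & Hw).
  exists d. split; [exact Hd|]. intros s Hs. rewrite !expi_cexp. apply Hw; [exact I|].
  eapply Rle_lt_trans; [apply Cmod_le_sum|]. simpl.
  rewrite Rplus_opp_r, Rabs_R0, Rplus_0_l. exact Hs.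
Qed.

Definition ext (cl op : C -> Prop) (z0 : C) (r : R) (u G : C -> C) : Prop :=
  regular cl op z0 r G /\ forall z, disk_part unit_circle z0 r z -> G z = u z.

Definition locally_ext (cl op : C -> Prop) (z0 : C) (u : C -> C) : Prop :=
  exists r, 0 < r /\ exists G, ext cl op z0 r u G.

Definition nowhere_ext (cl op : C -> Prop) (k : kreg) (u : C -> C) : Prop :=
  inCk k u /\ forall z0, unit_circle z0 -> ~ locally_ext cl op z0 u.

Lemma ext_sub (cl op : C -> Prop) (z0 z1 : C) (r s : R) (u G : C -> C) :
  s + Cmod (z1 - z0) <= r -> ext cl op z0 r u G -> ext cl op z1 s u G.
Proof.
  intros Hs [HG Hu].
  assert (Hsub : forall A z, disk_part A z1 s z -> disk_part A z0 r z).
  { intros A z [Hz HA]. split; [|exact HA]. assert (H := Cmod_sub_triangle z z1 z0). lra. }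
  split; [apply (regular_sub cl op _ _ z0 _ r); auto|auto].
Qed.

Lemma sqrt_vanishing (c : R) : 0 <= c -> vanishing (fun n => sqrt (c / (INR n + 1))).
Proof.
  intros Hc eps He.
  destruct (nfloor_ex (c / eps ^ 2)) as [n [_ Hn]].
  { apply Rle_div_r; [now apply pow_lt|lra]. }
  exists n. intros m Hm. apply le_INR in Hm. assert (H0 := pos_INR n).
  rewrite <- (sqrt_pow2 eps) by lra. apply sqrt_lt_1_alt.
  assert (He2 : 0 < eps ^ 2) by now apply pow_lt.
  split; [apply Rle_div_r; lra|].
  apply Rlt_div_l; [lra|]. apply Rlt_div_l in Hn; [|exact He2]. nra.
Qed.

Lemma uniform_limit_cont (S : C -> Prop) (f : nat -> C -> C) (g : C -> C) (e : nat -> R) :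
  vanishing e -> (forall i z, S z -> Cmod (f i z - g z) <= e i) ->
  forall z, S z -> (forall i, cont_at S (f i) z) -> cont_at S g z.
Proof.
  intros He Hg z Sz Hf eps Heps.
  destruct (He (eps / 3)) as [n Hn]; [lra|]. specialize (Hn n (le_n n)).
  destruct (Hf n (eps / 3)) as (d & Hd & Hw); [lra|]. exists d. split; [exact Hd|].
  intros w Sw Hwz. specialize (Hw w Sw Hwz).
  assert (H1 := Hg n w Sw). assert (H2 := Hg n z Sz). rewrite Cmod_sub_comm in H1.
  assert (H3 := Cmod_sub_triangle (g w) (f n w) (g z)).
  assert (H4 := Cmod_sub_triangle (f n w) (f n z) (g z)). lra.
Qed.

(* Two constants makes the extensions uniformly Cauchy near z0: boundedness replaces
   any appeal to normal families. *)
Lemma ext_limit (cl op : C -> Prop) (z0 : C) (r M : R) (u : C -> C) (v G : nat -> C -> C) :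
  two_constants cl op -> is_open op -> (forall z, op z -> cl z) ->
  (forall z, unit_circle z -> cl z) -> unit_circle z0 -> 0 < r ->
  (forall i, ext cl op z0 r (v i) (G i)) ->
  (forall i z, disk_part cl z0 r z -> Cmod (G i z) <= M) ->
  (forall i z, unit_circle z -> Cmod (v i z - u z) <= / (INR i + 1)) ->
  locally_ext cl op z0 u.
Proof.
  intros Htc Hop Hoc Huc H0 Hr HG HM Hv.
  destruct (Htc z0 r H0 Hr) as (rho & [Hrho Hrr] & T).
  set (N := Rmax M 1). assert (HN1 : 1 <= N) by apply Rmax_r. assert (HNM : M <= N) by apply Rmax_l.
  set (e := fun n => sqrt (4 * N / (INR n + 1))).
  assert (He : vanishing e) by (apply sqrt_vanishing; lra).
  assert (Hsub : forall A z, disk_part A z0 rho z -> disk_part A z0 r z).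
  { intros A z [H1 H2]. split; [lra|exact H2]. }
  assert (Hij : forall i j z, (i <= j)%nat -> disk_part cl z0 rho z -> Cmod (G i z - G j z) <= e i).
  { intros i j z Hle Hz.
    assert (Hi0 := pos_INR i). apply le_INR in Hle.
    assert (Hinv : / (INR j + 1) <= / (INR i + 1)) by (apply Rinv_le_contravar; lra).
    assert (Hinv0 : 0 < / (INR i + 1)) by (apply Rinv_0_lt_compat; lra).
    assert (Hinv1 : / (INR i + 1) <= 1) by (rewrite <- Rinv_1; apply Rinv_le_contravar; lra).
    assert (Hsq : Cmod (G i z - G j z) ^ 2 <= 2 * N * (2 * / (INR i + 1))).
    { apply (T (fun z => G i z - G j z)%C); [|lra| | |exact Hz].
      - destruct (HG i) as [[Ci Di] _], (HG j) as [[Cj Dj] _]. split.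
        + intros w Hw. apply cont_at_minus; auto.
        + intros w Hw. destruct (Di w Hw) as [a Ha], (Dj w Hw) as [b Hb].
          exists (a - b)%C. now apply cder_minus.
      - intros w Hw. assert (H1 := HM i w Hw). assert (H2 := HM j w Hw).
        assert (H3 := Cmod_triangle (G i w) (- G j w)). rewrite Cmod_opp in H3.
        unfold Cminus. lra.
      - intros w Hw. rewrite (proj2 (HG i) w Hw), (proj2 (HG j) w Hw).
        assert (H1 := Hv i w (proj2 Hw)). assert (H2 := Hv j w (proj2 Hw)).
        rewrite Cmod_sub_comm in H2. assert (H3 := Cmod_sub_triangle (v i w) (u w) (v j w)). lra. }
    unfold e. rewrite <- (sqrt_pow2 (Cmod (G i z - G j z))) by apply Cmod_ge_0.
    apply sqrt_le_1_alt. eapply Rle_trans; [exact Hsq|]. right. field. lra. }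
  assert (Hlim : forall z, disk_part cl z0 rho z -> exists l, forall i, Cmod (G i z - l) <= e i).
  { intros z Hz. apply (C_complete (fun i => G i z) e He). intros i j Hle. now apply Hij. }
  set (g := fun z => match excluded_middle_informative (disk_part cl z0 rho z) with
    | left H => proj1_sig (constructive_indefinite_description _ (Hlim z H))
    | right _ => RtoC 0 end).
  assert (Hg : forall i z, disk_part cl z0 rho z -> Cmod (G i z - g z) <= e i).
  { intros i z Hz. unfold g. destruct excluded_middle_informative as [H|H]; [|tauto].
    destruct constructive_indefinite_description as [l Hl]. apply Hl. }
  exists rho. split; [exact Hrho|]. exists g. split; [split|].
  - intros z Hz. apply (uniform_limit_cont (disk_part cl z0 rho) G g e He Hg z Hz).
    intros i. apply (cont_at_sub (disk_part cl z0 r)); [apply Hsub|].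
    apply (proj1 (proj1 (HG i))). now apply Hsub.
  - assert (Hoc' : forall z, disk_part op z0 rho z -> disk_part cl z0 rho z).
    { intros z [H1 H2]. split; auto. }
    apply (weierstrass (disk_part op z0 rho) G g e); auto.
    + intros z [Hz1 Hz2]. destruct (Hop z Hz2) as (d & Hd & Hw).
      destruct (open_Cmod_lt z0 rho z Hz1) as (d' & Hd' & Hw').
      exists (Rmin d d'). split; [now apply Rmin_pos|]. intros w Hwz. split.
      * apply Hw'. eapply Rlt_le_trans; [exact Hwz|apply Rmin_r].
      * apply Hw. eapply Rlt_le_trans; [exact Hwz|apply Rmin_l].
    + intros i z Hz. apply (proj2 (proj1 (HG i))). now apply Hsub.
  (* On the arc [G i z] converges both to [g z] and to [u z]; an index making each error less than
     half the gap separates them. *)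
  - intros z Hz. apply NNPP. intros Hn. assert (Hp := Cmod_sub_pos _ _ Hn).
    assert (Hzc : disk_part cl z0 rho z) by (split; [apply Hz|apply Huc, Hz]).
    destruct (He (Cmod (g z - u z) / 2)) as [n Hn']; [lra|].
    destruct (nfloor_ex (2 / Cmod (g z - u z))) as [m [_ Hm]]; [apply Rle_div_r; lra|].
    set (i := max n m). specialize (Hn' i ltac:(unfold i; lia)).
    assert (Him : INR m <= INR i) by (apply le_INR; unfold i; lia).
    assert (H1 := Hg i z Hzc). rewrite Cmod_sub_comm in H1.
    assert (H2 := Hv i z (proj2 Hz)).
    rewrite <- (proj2 (HG i) z (Hsub _ _ Hz)) in H2.
    assert (H3 := Cmod_sub_triangle (g z) (G i z) (u z)).
    assert (H4 : / (INR i + 1) < Cmod (g z - u z) / 2).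
    { apply Rlt_div_l in Hm; [|exact Hp]. assert (H5 := pos_INR m).
      rewrite <- (Rmult_1_l (/ (INR i + 1))). apply Rlt_div_l; [lra|]. nra. }
    lra.
Qed.

(** In what follows [INR b + 1] is at once the denominator, the inverse of the radius and, for the
    G_delta property, the bound, so a pair of naturals indexes all the data. *)
Definition grid_point (a b : nat) : C := expi (INR a / (INR b + 1)).

(** Continuity of [G] at [z0] bounds it by [Cmod (G z0) + 1] nearby, and a small disk around a close
    grid point stays in that neighbourhood. *)
Lemma ext_at_grid_point (cl op : C -> Prop) (z0 : C) (u : C -> C) :
  (forall z, unit_circle z -> cl z) -> unit_circle z0 -> locally_ext cl op z0 u ->
  exists a b G, ext cl op (grid_point a b) (/ (INR b + 1)) u G /\
    forall z, disk_part cl (grid_point a b) (/ (INR b + 1)) z -> Cmod (G z) <= INR b + 1.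
Proof.
  intros Huc H0 (r & Hr & G & HG).
  destruct (proj1 (proj1 HG) z0) with (eps := 1) as (d & Hd & Hw).
  { split; [rewrite Cmod_sub_self; exact Hr|auto]. } { lra. }
  destruct (unit_expi z0 H0) as (t & Ht & Et).
  set (s := Rmin r d / 2).
  assert (Hs : 0 < s) by (assert (H := Rmin_pos r d Hr Hd); unfold s; lra).
  assert (Hsr : 2 * s <= r) by (unfold s; assert (H := Rmin_l r d); lra).
  assert (Hsd : 2 * s <= d) by (unfold s; assert (H := Rmin_r r d); lra).
  destruct (expi_continuous t s Hs) as (d' & Hd' & Hexp). rewrite <- Et in Hexp.
  assert (HG0 := Cmod_ge_0 (G z0)).
  assert (Hs' : 0 < / s) by now apply Rinv_0_lt_compat.
  assert (Hd'' : 0 < / d') by now apply Rinv_0_lt_compat.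
  (* One large [b] ensures the bound, a radius below [s] and a mesh below [d']. *)
  destruct (nfloor_ex (Cmod (G z0) + 1 + / s + / d')) as [b [_ Hb]]; [lra|].
  assert (Hb0 := pos_INR b).
  assert (Hbs : / (INR b + 1) < s).
  { rewrite <- (Rinv_inv s). apply Rinv_lt_contravar; [nra|lra]. }
  assert (Hbd : / (INR b + 1) < d').
  { rewrite <- (Rinv_inv d'). apply Rinv_lt_contravar; [nra|lra]. }
  destruct (nfloor_ex (t * (INR b + 1))) as [a [Ha1 Ha2]]; [nra|].
  assert (Hab : Rabs (INR a / (INR b + 1) - t) < d').
  { apply Rle_lt_trans with (/ (INR b + 1)); [|exact Hbd].
    replace (INR a / (INR b + 1) - t) with ((INR a - t * (INR b + 1)) * / (INR b + 1))
      by (field; lra).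
    rewrite Rabs_mult, (Rabs_pos_eq (/ (INR b + 1))) by (left; apply Rinv_0_lt_compat; lra).
    rewrite <- (Rmult_1_l (/ (INR b + 1))) at 2.
    apply Rmult_le_compat_r; [left; apply Rinv_0_lt_compat; lra|]. apply Rabs_le. lra. }
  specialize (Hexp _ Hab). fold (grid_point a b) in Hexp.
  exists a, b, G. split.
  - apply (ext_sub cl op z0 _ r); [lra|exact HG].
  - intros z [Hz1 Hz2]. assert (H := Cmod_sub_triangle z (grid_point a b) z0).
    assert (Hwz : Cmod (G z - G z0) < 1) by (apply Hw; [split; [lra|exact Hz2]|lra]).
    assert (H2 := Cmod_le_add_sub (G z) (G z0)). lra.
Qed.

Lemma close_unit (eps : R) (u v : C -> C) (d e : nat -> R -> C) (k : kreg) :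
  derivs k (fun t => u (expi t)) d -> derivs k (fun t => v (expi t)) e -> Defs.close 0 eps d e ->
  forall z, unit_circle z -> Cmod (v z - u z) < eps.
Proof.
  intros [Hd _] [He _] Hc z Hz. destruct (unit_expi z Hz) as (t & _ & ->).
  specialize (Hc O (le_n O) t). rewrite Cnorm_Cmod in Hc. rewrite Hd, He in Hc. exact Hc.
Qed.

(* The open sets are the complements of the closures of the sets of functions which
   extend from grid points with a given radius and bound. *)
Lemma nowhere_ext_Gdelta (cl op : C -> Prop) (k : kreg) :
  two_constants cl op -> is_open op -> (forall z, op z -> cl z) ->
  (forall z, unit_circle z -> cl z) -> Ck_Gdelta k (nowhere_ext cl op k).
Proof.
  intros Htc Hop Hoc Huc.
  set (E := fun a b (u : C -> C) => exists G, ext cl op (grid_point a b) (/ (INR b + 1)) u G /\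
    forall z, disk_part cl (grid_point a b) (/ (INR b + 1)) z -> Cmod (G z) <= INR b + 1).
  set (near := fun eps (u v : C -> C) => forall z, unit_circle z -> Cmod (v z - u z) < eps).
  exists (fun n u => inCk k u /\ exists eps, 0 < eps /\
    forall v, near eps u v -> ~ E (fst (of_nat n)) (snd (of_nat n)) v).
  split.
  - intros n. split; [tauto|]. intros u d [Hu (eps & He & Hn)] Hd.
    (* The set is open already for uniform convergence, so the seminorm of order 0 is enough for
       every [k]. *)
    exists O, (eps / 2). split; [destruct k; simpl; auto with arith|]. split; [lra|].
    intros v e Hv Hclose. split; [now exists e|]. exists (eps / 2). split; [lra|].
    intros w Hw. apply Hn. intros z Hz. specialize (Hw z Hz).
    assert (H1 := close_unit _ u v d e k Hd Hv Hclose z Hz).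
    assert (H2 := Cmod_sub_triangle (w z) (v z) (u z)). lra.
  - intros u. split.
    + intros [Hu Hno] n. split; [exact Hu|].
      set (a := fst (of_nat n)). set (b := snd (of_nat n)). apply NNPP. intros Hn.
      (* Otherwise [u] is a uniform limit of functions extending with one radius and one bound, and
         [ext_limit] makes it extend too. *)
      assert (Hseq : forall i : nat, exists v, exists G, near (/ (INR i + 1)) u v /\
        ext cl op (grid_point a b) (/ (INR b + 1)) v G /\
        forall z, disk_part cl (grid_point a b) (/ (INR b + 1)) z -> Cmod (G z) <= INR b + 1).
      { intros i. apply NNPP. intros Hi. apply Hn. exists (/ (INR i + 1)). split.
        - apply Rinv_0_lt_compat. assert (H := pos_INR i). lra.
        - intros v Hv [G HG]. apply Hi. exists v, G. tauto. }
      set (v := fun i => proj1_sig (constructive_indefinite_description _ (Hseq i))).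
      assert (Hv : forall i, exists G, near (/ (INR i + 1)) u (v i) /\
        ext cl op (grid_point a b) (/ (INR b + 1)) (v i) G /\
        forall z, disk_part cl (grid_point a b) (/ (INR b + 1)) z -> Cmod (G z) <= INR b + 1).
      { intros i. unfold v. destruct constructive_indefinite_description. assumption. }
      set (G := fun i => proj1_sig (constructive_indefinite_description _ (Hv i))).
      assert (HG : forall i, near (/ (INR i + 1)) u (v i) /\
        ext cl op (grid_point a b) (/ (INR b + 1)) (v i) (G i) /\
        forall z, disk_part cl (grid_point a b) (/ (INR b + 1)) z -> Cmod (G i z) <= INR b + 1).
      { intros i. unfold G. destruct constructive_indefinite_description. assumption. }
      apply (Hno (grid_point a b)); [apply expi_unit|].
      apply (ext_limit cl op (grid_point a b) (/ (INR b + 1)) (INR b + 1) u v G); auto.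
      * apply expi_unit.
      * apply Rinv_0_lt_compat. assert (H := pos_INR b). lra.
      * intros i. apply HG.
      * intros i. apply HG.
      * intros i z Hz. left. now apply HG.
    + intros HO. split; [apply (HO O)|]. intros z0 H0 Hext.
      destruct (ext_at_grid_point cl op z0 u Huc H0 Hext) as (a & b & G & HG & HM).
      destruct (HO (to_nat (a, b))) as [_ (eps & He & Hn)].
      rewrite cancel_of_to in Hn. apply (Hn u).
      * intros z _. rewrite Cmod_sub_self. exact He.
      * exists G. split; assumption.
Qed.

(** Regularity is stated in the angle, so descending to the circle takes a continuous local inverse
    of [expi]: near [expi t] the angle is [t] plus the [asin] of the imaginary part of
    [w * Cconj (expi t)]. *)
Lemma Ck_continuous (k : kreg) (u : C -> C) (z : C) :
  inCk k u -> unit_circle z -> cont_at unit_circle u z.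
Proof.
  intros [d (Hd0 & Hdc & _)] Hz eps He. destruct (unit_expi z Hz) as (t & _ & ->).
  destruct (Hdc O) as [C1 C2]; [destruct k; simpl; auto with arith|].
  destruct (C1 t (eps / 2)) as (d1 & Hd1 & H1); [lra|].
  destruct (C2 t (eps / 2)) as (d2 & Hd2 & H2); [lra|].
  set (m := Rmin d1 d2). assert (Hm : 0 < m) by now apply Rmin_pos.
  assert (Hasin : continuity_pt asin 0) by (apply derivable_continuous_pt, derivable_pt_asin; lra).
  destruct (Hasin m Hm) as (d3 & Hd3 & H3). rewrite asin_0 in H3.
  (* Distance below 1 makes the real part of [q] positive, so it is the square root given by
     [cos_asin]. *)
  exists (Rmin d3 1). split; [apply Rmin_pos; lra|]. intros w Hw Hwt.
  assert (Hw3 := Rlt_le_trans _ _ _ Hwt (Rmin_l _ _)).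
  assert (Hw1 := Rlt_le_trans _ _ _ Hwt (Rmin_r _ _)).
  assert (Hq_ex : exists q, q = (w * Cconj (expi t))%C) by eauto. destruct Hq_ex as [q Eq].
  assert (Hq1 : Cmod (q - 1) = Cmod (w - expi t)).
  { assert (E : (expi t * Cconj (expi t))%C = 1).
    { rewrite <- Cmod2_conj, (expi_unit t), RtoC_pow. ring. }
    replace (q - 1)%C with ((w - expi t) * Cconj (expi t))%C by (rewrite Eq, <- E; ring).
    rewrite Cmod_mult, Cmod_conj, (expi_unit t). ring. }
  assert (Hq : Cmod q = 1) by (rewrite Eq, Cmod_mult, Cmod_conj, (expi_unit t), Hw; ring).
  assert (Hq2 := Cmod_sqr q). rewrite Hq in Hq2.
  assert (Hf := fst_le_Cmod (q - 1)). assert (Hg := im_le_Cmod (q - 1)).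
  rewrite Hq1 in Hf, Hg. simpl in Hf, Hg. set (x := fst q) in *. set (y := snd q) in *.
  replace (y + - 0) with y in Hg by ring.
  assert (Hx : 0 < x) by (apply Rabs_le_between in Hf; lra).
  assert (Hy : -1 <= y <= 1) by (apply Rabs_le_between in Hg; lra).
  set (s := asin y).
  assert (Hsin : sin s = y) by (apply sin_asin; exact Hy).
  assert (Hcos : cos s = x).
  { unfold s. rewrite cos_asin by exact Hy. rewrite <- (sqrt_pow2 x) by lra. f_equal.
    unfold Rsqr. lra. }
  assert (Ew : w = expi (t + s)).
  { assert (E : w = (q * expi t)%C).
    { rewrite Eq, <- Cmult_assoc, (Cmult_comm (Cconj _)), <- Cmod2_conj, (expi_unit t), RtoC_pow.
      ring. }
    rewrite E. unfold expi. rewrite cos_plus, sin_plus, Hcos, Hsin.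
    apply injective_projections; simpl; fold x y; ring. }
  assert (Hs : Rabs s < m).
  { destruct (Req_dec y 0) as [E|E].
    - unfold s. rewrite E, asin_0, Rabs_R0. exact Hm.
    - specialize (H3 y). simpl in H3. unfold Rdist in H3. rewrite !Rminus_0_r in H3.
      apply H3. split; [split; [exact I|lra]|lra]. }
  rewrite Ew, <- !Hd0.
  destruct (Req_dec s 0) as [E|E].
  - rewrite E, Rplus_0_r, Cmod_sub_self. exact He.
  - eapply Rle_lt_trans; [apply Cmod_le_sum|].
    assert (Hdist : Rabs (t + s - t) < m) by (now replace (t + s - t) with s by ring).
    specialize (H1 (t + s)). specialize (H2 (t + s)). simpl in H1, H2. unfold Rdist in H1, H2.
    assert (A1 := H1 ltac:(split; [split; [exact I|lra]|
      apply Rlt_le_trans with (1 := Hdist), Rmin_l])).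
    assert (A2 := H2 ltac:(split; [split; [exact I|lra]|
      apply Rlt_le_trans with (1 := Hdist), Rmin_r])).
    simpl. unfold Rminus in A1, A2. lra.
Qed.

(** The classes ask for continuity on all of T, [regular] only inside the disk. The gap is closed by
    gluing [u] on T to [G] elsewhere, [u] being continuous on T. *)
Lemma locally_ext_iff (cl op op' : C -> Prop) (k : kreg) (z0 : C) (u : C -> C) :
  is_open op -> (forall z, op' z <-> op z) -> (forall z, op z -> ~ unit_circle z) ->
  (forall z, cl z <-> unit_circle z \/ op z) -> inCk k u ->
  locally_ext cl op z0 u <->
  exists r, 0 < r /\ exists lam : C -> C,
    cont_on (fun z => onT z \/ (Disk z0 r z /\ op' z)) lam /\
    holo_on (fun z => Disk z0 r z /\ op' z) lam /\
    (forall z, Disk z0 r z -> onT z -> lam z = u z).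
Proof.
  intros Hop Hop' Hou Hcl Hu.
  assert (HD : forall r z, Disk z0 r z <-> Cmod (z - z0) < r).
  { intros r z. unfold Disk. now rewrite Cnorm_Cmod. }
  assert (Hopen : forall r, is_open (fun z => Disk z0 r z /\ op' z)).
  { intros r z [H1 H2]. apply HD in H1. apply Hop' in H2.
    destruct (Hop z H2) as (d & Hd & Hw). destruct (open_Cmod_lt z0 r z H1) as (d' & Hd' & Hw').
    exists (Rmin d d'). split; [now apply Rmin_pos|]. intros w Hwz. split.
    - apply HD, Hw'. eapply Rlt_le_trans; [exact Hwz|apply Rmin_r].
    - apply Hop', Hw. eapply Rlt_le_trans; [exact Hwz|apply Rmin_l]. }
  split.
  - intros (r & Hr & G & [Gc Gd] & HGu).
    set (lam := fun z => if excluded_middle_informative (unit_circle z) then u z else G z).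
    assert (Hlam_T : forall z, unit_circle z -> lam z = u z).
    { intros z Hz. unfold lam. destruct excluded_middle_informative; tauto. }
    assert (Hlam_G : forall z, disk_part cl z0 r z -> lam z = G z).
    { intros z Hz. unfold lam. destruct excluded_middle_informative as [H|H]; [|reflexivity].
      symmetry. apply HGu. split; [apply Hz|exact H]. }
    (* Halving the radius keeps the open part at distance at least [r / 2] from the points of T
       outside the larger disk, where only the continuity of [u] is at hand. *)
    exists (r / 2). split; [lra|]. exists lam. split; [|split].
    + apply cont_on_iff. intros z Hz.
      assert (Hset : forall w, onT w \/ Disk z0 (r / 2) w /\ op' w -> cl w).
      { intros w Hw. apply Hcl. rewrite onT_unit, Hop' in Hw. tauto. }
      destruct (Rlt_dec (Cmod (z - z0)) r) as [Hlt|Hge].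
      * destruct (open_Cmod_lt z0 r z Hlt) as (d & Hd & Hw).
        assert (Hzd : disk_part cl z0 r z) by (split; auto).
        intros eps He. destruct (Gc z Hzd eps He) as (d' & Hd' & Hw').
        exists (Rmin d d'). split; [now apply Rmin_pos|]. intros w Sw Hwz.
        assert (Hwd : disk_part cl z0 r w).
        { split; [apply Hw; eapply Rlt_le_trans; [exact Hwz|apply Rmin_l]|auto]. }
        rewrite !Hlam_G by assumption. apply Hw'; [exact Hwd|].
        eapply Rlt_le_trans; [exact Hwz|apply Rmin_r].
      * assert (Hzu : unit_circle z).
        { destruct Hz as [Hz|[Hz _]]; [now apply onT_unit|]. apply HD in Hz. lra. }
        intros eps He. destruct (Ck_continuous k u z Hu Hzu eps He) as (d & Hd & Hw).
        exists (Rmin d (r / 2)). split; [apply Rmin_pos; lra|]. intros w Sw Hwz.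
        assert (Hwu : unit_circle w).
        { destruct Sw as [Sw|[Sw _]]; [now apply onT_unit|]. exfalso. apply HD in Sw.
          assert (H := Cmod_sub_triangle z w z0). rewrite (Cmod_sub_comm z w) in H.
          assert (H1 := Rlt_le_trans _ _ _ Hwz (Rmin_r _ _)). lra. }
        rewrite !Hlam_T by assumption. apply Hw; [exact Hwu|].
        eapply Rlt_le_trans; [exact Hwz|apply Rmin_l].
    + apply holo_on_iff; [apply Hopen|]. intros z Hz.
      destruct (Hopen _ z Hz) as (d & Hd & Hw).
      assert (Hin : forall w, Disk z0 (r / 2) w /\ op' w -> disk_part op z0 r w).
      { intros w [H1 H2]. split; [apply HD in H1; lra|now apply Hop']. }
      destruct (Gd z (Hin z Hz)) as [l Hl]. exists l.
      apply (cder_ext_loc G) with (r := d); [exact Hd| |exact Hl].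
      intros w Hwz. symmetry. apply Hlam_G. destruct (Hin w (Hw w Hwz)) as [H1 H2].
      split; [exact H1|]. apply Hcl. now right.
    + intros z _ Hz. apply Hlam_T. now apply onT_unit.
  - intros (r & Hr & lam & Hc & Hh & Hl). exists r. split; [exact Hr|]. exists lam.
    rewrite cont_on_iff in Hc. rewrite holo_on_iff in Hh by apply Hopen.
    assert (Hset : forall w, disk_part cl z0 r w -> onT w \/ Disk z0 r w /\ op' w).
    { intros w [H1 H2]. rewrite onT_unit, HD, Hop'. apply Hcl in H2. tauto. }
    split; [split|].
    + intros z Hz. apply (cont_at_sub _ _ _ _ Hset). apply Hc. now apply Hset.
    + intros z [H1 H2]. apply Hh. now rewrite HD, Hop'.
    + intros z [H1 H2]. apply Hl; [now apply HD|now apply onT_unit].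
Qed.

(** * The classes U2 to U5 as sets of nowhere extendable functions *)

Lemma open_op_in : is_open op_in.
Proof.
  intros z Hz. unfold op_in in *. exists (1 - Cmod z). split; [lra|]. intros w Hw.
  assert (H := Cmod_le_add_sub w z). lra.
Qed.

Lemma open_op_out : is_open op_out.
Proof.
  intros z Hz. unfold op_out in *. exists (Cmod z - 1). split; [lra|]. intros w Hw.
  assert (H := Cmod_le_add_sub z w). rewrite (Cmod_sub_comm z) in H. lra.
Qed.

Lemma open_everywhere : is_open everywhere.
Proof. intros z _. exists 1. split; [lra|]. intros w _. exact I. Qed.

Lemma inCk_of_Uall (Uz : kreg -> Cx -> (Cx -> Cx) -> Prop) (k : kreg) (u : C -> C) :
  (forall z0, Uz k z0 u -> inCk k u) -> Uall Uz k u -> inCk k u.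
Proof. intros H Hu. apply (H (expi 0)), Hu, onT_unit, expi_unit. Qed.

Lemma U2_iff (k : kreg) (u : C -> C) : Uall U2z k u <-> nowhere_ext cl_out op_out k u.
Proof.
  assert (Hiff : forall z0, inCk k u -> locally_ext cl_out op_out z0 u <-> _) by
    (intros z0; apply (locally_ext_iff cl_out op_out (fun z => 1 < Cnorm z) k z0 u open_op_out);
     [intros z; rewrite Cnorm_Cmod; reflexivity
     |intros z Hz; unfold op_out, unit_circle in *; lra
     |intros z; unfold cl_out, op_out, unit_circle; lra]).
  split.
  - intros H. assert (Hu : inCk k u) by (apply (inCk_of_Uall U2z); [intros z0 Hz; apply Hz|exact H]).
    split; [exact Hu|]. intros z0 H0 Hext. apply Hiff in Hext; [|exact Hu].
    apply onT_unit in H0. destruct (H z0 H0) as [_ Hn]. apply Hn. exact Hext.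
  - intros [Hu Hn] z0 H0. split; [exact Hu|]. intros Hext. apply onT_unit in H0.
    apply (Hn z0 H0). apply Hiff; [exact Hu|exact Hext].
Qed.

Lemma U3_iff (k : kreg) (u : C -> C) : Uall U3z k u <-> nowhere_ext cl_in op_in k u.
Proof.
  assert (Hiff : forall z0, inCk k u -> locally_ext cl_in op_in z0 u <-> _) by
    (intros z0; apply (locally_ext_iff cl_in op_in (fun z => Cnorm z < 1) k z0 u open_op_in);
     [intros z; rewrite Cnorm_Cmod; reflexivity
     |intros z Hz; unfold op_in, unit_circle in *; lra
     |intros z; unfold cl_in, op_in, unit_circle; lra]).
  split.
  - intros H. assert (Hu : inCk k u) by (apply (inCk_of_Uall U3z); [intros z0 Hz; apply Hz|exact H]).
    split; [exact Hu|]. intros z0 H0 Hext. apply Hiff in Hext; [|exact Hu].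
    apply onT_unit in H0. destruct (H z0 H0) as [_ Hn]. apply Hn. exact Hext.
  - intros [Hu Hn] z0 H0. split; [exact Hu|]. intros Hext. apply onT_unit in H0.
    apply (Hn z0 H0). apply Hiff; [exact Hu|exact Hext].
Qed.

Lemma U4_iff (k : kreg) (u : C -> C) : Uall U4z k u <-> Uall U2z k u /\ Uall U3z k u.
Proof. unfold Uall, U4z. firstorder. Qed.

Lemma U5_iff (k : kreg) (u : C -> C) : Uall U5z k u <-> nowhere_ext everywhere everywhere k u.
Proof.
  assert (HD : forall z0 r z, Disk z0 r z <-> Cmod (z - z0) < r).
  { intros z0 r z. unfold Disk. now rewrite Cnorm_Cmod. }
  assert (Hopen : forall z0 r, is_open (Disk z0 r)).
  { intros z0 r z Hz. apply HD in Hz. destruct (open_Cmod_lt z0 r z Hz) as (d & Hd & Hw).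
    exists d. split; [exact Hd|]. intros w Hwz. now apply HD, Hw. }
  assert (Hiff : forall z0, locally_ext everywhere everywhere z0 u <->
    exists r, 0 < r /\ exists F : C -> C, holo_on (Disk z0 r) F /\
      forall z, Disk z0 r z -> onT z -> F z = u z).
  { intros z0. split; intros (r & Hr & F & HF); exists r; (split; [exact Hr|]); exists F.
    - destruct HF as [[_ Fd] Fu]. rewrite holo_on_iff by apply Hopen. split.
      + intros z Hz. apply Fd. split; [now apply HD|exact I].
      + intros z Hz HT. apply Fu. split; [now apply HD|now apply onT_unit].
    - rewrite holo_on_iff in HF by apply Hopen. destruct HF as [Fd Fu].
      assert (Fd' : forall z, disk_part everywhere z0 r z -> exists l, cder F z l).
      { intros z [Hz _]. apply Fd. now apply HD. }
      split; [split; [|exact Fd']|].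
      + intros z Hz. destruct (Fd' z Hz) as [l Hl]. now apply (cder_cont_at _ _ l).
      + intros z [Hz HT]. apply Fu; [now apply HD|now apply onT_unit]. }
  split.
  - intros H. split; [apply (inCk_of_Uall U5z); [intros z0 Hz; apply Hz|exact H]|].
    intros z0 H0 Hext. apply onT_unit in H0. destruct (H z0 H0) as [_ Hn]. apply Hn, Hiff, Hext.
  - intros [Hu Hn] z0 H0. split; [exact Hu|]. intros Hext. apply onT_unit in H0.
    apply (Hn z0 H0). apply Hiff, Hext.
Qed.

Lemma Uall_U3_U5 (k : kreg) (u : C -> C) : Uall U3z k u -> Uall U5z k u.
Proof.
  rewrite U3_iff, U5_iff. intros [Hu Hn]. split; [exact Hu|].
  intros z0 H0 (r & Hr & G & HG & Hext). apply (Hn z0 H0). exists r. split; [exact Hr|].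
  exists G. split; [|exact Hext].
  apply (regular_sub everywhere everywhere _ _ z0 _ r);
    [intros z [Hz _]; split; [exact Hz|exact I]..|exact HG].
Qed.

Lemma Gdelta_iff (k : kreg) (A B : (C -> C) -> Prop) :
  (forall u, A u <-> B u) -> Ck_Gdelta k A -> Ck_Gdelta k B.
Proof.
  intros H (O & HO & HA). exists O. split; [exact HO|]. intros u. rewrite <- H. apply HA.
Qed.

Lemma Gdelta_and (k : kreg) (A B : (C -> C) -> Prop) :
  Ck_Gdelta k A -> Ck_Gdelta k B -> Ck_Gdelta k (fun u => A u /\ B u).
Proof.
  intros (O & HO & HA) (O' & HO' & HB).
  exists (fun n => if Nat.even n then O (Nat.div2 n) else O' (Nat.div2 n)). split.
  - intros n. destruct (Nat.even n); auto.
  - intros u. rewrite HA, HB. split.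
    + intros [H1 H2] n. destruct (Nat.even n); auto.
    + intros H. split; intros n.
      * specialize (H (2 * n)%nat). rewrite Nat.even_mul, Nat.div2_double in H. exact H.
      * specialize (H (S (2 * n))). rewrite Nat.even_succ, <- Nat.negb_even, Nat.even_mul in H.
        rewrite Nat.div2_succ_double in H. exact H.
Qed.

(** * A nowhere extendable lacunary series *)

(** Cantor's nested intervals. The right-hand choice starts beyond the midpoint because [s m] may be
    the midpoint itself. *)
Fixpoint avoiding (s : nat -> R) (lo hi : R) (n : nat) : R * R :=
  match n with
  | O => (lo, hi)
  | S m =>
    let (a, b) := avoiding s lo hi m in
    if Rle_dec (s m) ((a + b) / 2) then ((a + 3 * b) / 4, b) else (a, (a + b) / 2)
  end.

Lemma exists_avoiding_sequence (s : nat -> R) (lo hi : R) :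
  lo < hi -> exists c, lo <= c <= hi /\ forall n, c <> s n.
Proof.
  intros Hlt. set (f := avoiding s lo hi).
  assert (Hf : forall n, fst (f n) < snd (f n)).
  { unfold f. induction n as [|n IH]; simpl; [exact Hlt|].
    destruct (avoiding s lo hi n) as [a b]. simpl in IH. destruct Rle_dec; simpl; lra. }
  assert (HS : forall n, fst (f n) <= fst (f (S n)) /\ snd (f (S n)) <= snd (f n) /\
    (s n < fst (f (S n)) \/ snd (f (S n)) < s n)).
  { intros n. specialize (Hf n). unfold f in *. simpl.
    destruct (avoiding s lo hi n) as [a b]. simpl in *. destruct Rle_dec; simpl; lra. }
  destruct (nested_intervals (fun n => fst (f n)) (fun n => snd (f n))) as [c Hc].
  - intros n. left. apply Hf.
  - intros n. apply HS.
  - intros n. apply HS.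
  - exists c. split; [exact (Hc O)|]. intros n. specialize (Hc (S n)).
    destruct (HS n) as (_ & _ & H). lra.
Qed.

Lemma pow_le_exp (k : nat) : exists K, 0 < K /\ forall x, 0 <= x -> x ^ k <= K * exp x.
Proof.
  induction k as [|k (K & HK & IH)].
  - exists 1. split; [lra|]. intros x Hx. simpl. rewrite Rmult_1_l, <- exp_0.
    now apply exp_le_compat.
  - exists (2 * 2 ^ k * K). split.
    { assert (H := pow_lt 2 k ltac:(lra)). nra. }
    intros x Hx. specialize (IH (x / 2) ltac:(lra)).
    replace (x ^ S k) with ((2 * (x / 2)) * (2 ^ k * (x / 2) ^ k))
      by (rewrite <- Rpow_mult_distr; simpl; replace (2 * (x / 2)) with x by field; reflexivity).
    replace (exp x) with (exp (x / 2) * exp (x / 2)) by (rewrite <- exp_plus; f_equal; field).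
    assert (H2 := exp_ineq1_le (x / 2)). assert (H3 := pow_lt 2 k ltac:(lra)).
    assert (H4 : 0 <= (x / 2) ^ k) by (apply pow_le; lra).
    replace (2 * 2 ^ k * K * (exp (x / 2) * exp (x / 2)))
      with ((2 * exp (x / 2)) * (2 ^ k * (K * exp (x / 2)))) by ring.
    apply Rmult_le_compat; [lra| |lra|apply Rmult_le_compat_l; lra].
    apply Rmult_le_pos; lra.
Qed.

(** * Partial sums and majorants of real series *)

Fixpoint psum (f : nat -> R) (n : nat) : R :=
  match n with O => 0 | S k => psum f k + f k end.

Lemma Series_psum (f : nat -> R) (n : nat) :
  ex_series f -> Series f = psum f n + Series (fun k => f (n + k)%nat).
Proof.
  intros Hf. induction n as [|n IH].
  - simpl. rewrite Rplus_0_l. reflexivity.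
  - rewrite IH, Series_incr_1 by (now apply ex_series_incr_n). simpl.
    rewrite Nat.add_0_r, Rplus_assoc. do 2 f_equal. apply Series_ext. intros k.
    now rewrite Nat.add_succ_r.
Qed.

Lemma Series_nonneg (f : nat -> R) : (forall n, 0 <= f n) -> ex_series f -> 0 <= Series f.
Proof.
  intros H Hf. replace 0 with (Series (fun _ => 0)).
  - apply Series_le; [|exact Hf]. intros n. split; [lra|apply H].
  - rewrite (Series_ext _ (fun n => 0 * f n)) by (intros; ring). rewrite Series_scal_l. ring.
Qed.

Lemma Series_Rabs_le (f g : nat -> R) :
  (forall n, Rabs (f n) <= g n) -> ex_series g -> ex_series f /\ Rabs (Series f) <= Series g.
Proof.
  intros H Hg. assert (Ha : ex_series (fun n => Rabs (f n))).
  { apply (ex_series_le (V := R_CompleteNormedModule) _ g); [|exact Hg]. intros n.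
    unfold norm; simpl. unfold abs; simpl. rewrite Rabs_Rabsolu. apply H. }
  split; [now apply ex_series_Rabs|]. eapply Rle_trans; [now apply Series_Rabs|].
  apply Series_le; [|exact Hg]. intros n. split; [apply Rabs_pos|apply H].
Qed.

Lemma ex_series_scaled_geom (q c : R) : 0 <= q < 1 -> ex_series (fun n => c * q ^ n).
Proof.
  intros Hq. apply (ex_series_scal_l (V := R_NormedModule) c).
  apply ex_series_geom. rewrite Rabs_pos_eq; lra.
Qed.

(* Coefficients decay faster than any power of the frequencies, but slower than any
   geometric sequence in the frequency gaps. *)
Definition coef (n : nat) : R := exp (- 4 ^ n).
Definition freq (n : nat) : nat := (16 ^ n)%nat.

Lemma INR_freq (n : nat) : INR (freq n) = (4 ^ n) ^ 2.
Proof.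
  unfold freq. rewrite pow_INR. replace (INR 16) with (4 ^ 2) by (simpl; ring).
  now rewrite <- !pow_mult, Nat.mul_comm.
Qed.

Lemma coef_pos (n : nat) : 0 < coef n.
Proof. apply exp_pos. Qed.

Lemma pow4_ge (n : nat) : 1 + INR n <= 4 ^ n.
Proof. induction n as [|n IH]; [simpl; lra|]. rewrite S_INR. simpl. assert (H := pos_INR n). lra. Qed.

Lemma coef_freq_summable (l : nat) : ex_series (fun n => coef n * INR (freq n) ^ l).
Proof.
  destruct (pow_le_exp (2 * l + 1)) as (K & HK & Hpow).
  apply (ex_series_le (V := R_CompleteNormedModule) _ (fun n => K * (/ 4) ^ n));
    [|apply ex_series_scaled_geom; lra].
  intros n. unfold norm; simpl. unfold abs; simpl.
  assert (H4 : 0 < 4 ^ n) by (apply pow_lt; lra).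
  rewrite INR_freq. rewrite Rabs_pos_eq.
  2:{ apply Rmult_le_pos; [left; apply coef_pos|]. apply pow_le, pow_le. lra. }
  specialize (Hpow (4 ^ n) ltac:(lra)). unfold coef.
  rewrite pow_inv. apply (Rmult_le_reg_r (4 ^ n)); [exact H4|].
  replace (K * / 4 ^ n * 4 ^ n) with K by (field; lra).
  rewrite pow_add, pow_1, pow_mult in Hpow.
  apply (Rmult_le_reg_l (exp (4 ^ n))); [apply exp_pos|].
  replace (exp (4 ^ n) * (exp (- 4 ^ n) * ((4 ^ n) ^ 2) ^ l * 4 ^ n))
    with ((exp (4 ^ n) * exp (- 4 ^ n)) * (((4 ^ n) ^ 2) ^ l * 4 ^ n)) by ring.
  rewrite <- exp_plus, Rplus_opp_r, exp_0. lra.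
Qed.

Lemma coef_summable : ex_series coef.
Proof.
  apply (ex_series_ext (V := R_NormedModule) (fun n => coef n * INR (freq n) ^ 0));
    [intros n; apply Rmult_1_r|apply coef_freq_summable].
Qed.

(** Only the values on the circle matter, where the terms are [coef n * cos (INR (freq n) * t)]. *)
Definition lacunary (z : C) : C := (Series (fun n => coef n * fst (z ^ freq n)%C), 0).

(** Each differentiation of a cosine advances its phase by [PI / 2], so one formula covers all
    orders. *)
Definition lacunary_deriv (l : nat) (t : R) : R :=
  Series (fun n => coef n * INR (freq n) ^ l * cos (INR (freq n) * t + INR l * (PI / 2))).

Lemma expi_pow (t : R) (n : nat) : (expi t ^ n)%C = expi (INR n * t).
Proof.
  induction n as [|n IH].
  - simpl. rewrite Rmult_0_l. unfold expi. now rewrite cos_0, sin_0.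
  - rewrite Cpow_S, IH, S_INR, !expi_cexp, <- cexp_plus. f_equal.
    apply injective_projections; simpl; ring.
Qed.

Lemma lacunary_deriv_term (l n : nat) (t : R) :
  Rabs (coef n * INR (freq n) ^ l * cos (INR (freq n) * t + INR l * (PI / 2)))
    <= coef n * INR (freq n) ^ l.
Proof.
  assert (H : 0 <= coef n * INR (freq n) ^ l).
  { apply Rmult_le_pos; [left; apply coef_pos|apply pow_le, pos_INR]. }
  rewrite Rabs_mult, (Rabs_pos_eq _ H). rewrite <- (Rmult_1_r (coef n * INR (freq n) ^ l)) at 2.
  apply Rmult_le_compat_l; [exact H|]. apply Rabs_le.
  destruct (COS_bound (INR (freq n) * t + INR l * (PI / 2))). lra.
Qed.

Lemma lacunary_deriv_bound (l : nat) (t : R) :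
  Rabs (lacunary_deriv l t) <= Series (fun n => coef n * INR (freq n) ^ l).
Proof.
  apply Series_Rabs_le; [intros n; apply lacunary_deriv_term|apply coef_freq_summable].
Qed.

Lemma sin_lipschitz (x y : R) : Rabs (sin x - sin y) <= Rabs (x - y).
Proof.
  destruct (MVT_gen sin y x cos) as (c & _ & E).
  - intros z _. auto_derive; [exact I|ring].
  - intros z _. apply continuity_sin.
  - rewrite E, Rabs_mult. rewrite <- (Rmult_1_l (Rabs (x - y))) at 2.
    apply Rmult_le_compat_r; [apply Rabs_pos|]. apply Rabs_le. destruct (COS_bound c). lra.
Qed.

Lemma cos_taylor (x h : R) : Rabs (cos (x + h) - cos x + h * sin x) <= h ^ 2.
Proof.
  destruct (MVT_gen cos x (x + h) (fun z => - sin z)) as (c & Hc & E).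
  - intros z _. auto_derive; [exact I|ring].
  - intros z _. apply continuity_cos.
  - rewrite E. replace (- sin c * (x + h - x) + h * sin x) with (h * (sin x - sin c)) by ring.
    rewrite Rabs_mult, <- pow2_abs. simpl. rewrite Rmult_1_r.
    apply Rmult_le_compat_l; [apply Rabs_pos|].
    eapply Rle_trans; [apply sin_lipschitz|].
    unfold Rmin, Rmax in Hc. destruct (Rle_dec x (x + h)).
    + rewrite (Rabs_pos_eq h) by lra. apply Rabs_le. lra.
    + rewrite (Rabs_left h) by lra. apply Rabs_le. lra.
Qed.

(** The second-order remainders are bounded term by term by [cos_taylor], and the bounds sum to
    [h ^ 2 * B] with [B] finite. *)
Lemma lacunary_deriv_correct (l : nat) (t : R) :
  derivable_pt_lim (lacunary_deriv l) t (lacunary_deriv (S l) t).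
Proof.
  set (B := Series (fun n => coef n * INR (freq n) ^ (S (S l)))).
  assert (HB : 0 <= B).
  { apply Series_nonneg; [|apply coef_freq_summable]. intros n.
    apply Rmult_le_pos; [left; apply coef_pos|apply pow_le, pos_INR]. }
  assert (Hex : forall l t, ex_series (fun n =>
    coef n * INR (freq n) ^ l * cos (INR (freq n) * t + INR l * (PI / 2)))).
  { intros l' t'. eapply Series_Rabs_le; [intros n; apply lacunary_deriv_term|].
    apply coef_freq_summable. }
  assert (Hh : forall h, Rabs (lacunary_deriv l (t + h) - lacunary_deriv l t -
      h * lacunary_deriv (S l) t) <= h ^ 2 * B).
  { intros h. unfold lacunary_deriv, B.
    rewrite <- Series_scal_l, <- Series_scal_l.
    rewrite <- Series_minus by apply Hex.
    rewrite <- Series_minus by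
      first [apply (ex_series_minus (V := R_NormedModule)); apply Hex
            |apply (ex_series_scal_l (V := R_NormedModule)), Hex].
    apply Series_Rabs_le;
      [|apply (ex_series_scal_l (V := R_NormedModule)), coef_freq_summable].
    intros n. set (m := INR (freq n)). set (x := m * t + INR l * (PI / 2)).
    assert (Hm : 0 <= m) by apply pos_INR.
    replace (m * (t + h) + INR l * (PI / 2)) with (x + m * h) by (unfold x; ring).
    replace (m * t + INR (S l) * (PI / 2)) with (x + PI / 2) by (unfold x; rewrite S_INR; ring).
    rewrite (cos_plus x (PI / 2)), cos_PI2, sin_PI2.
    replace (coef n * m ^ l * cos (x + m * h) - coef n * m ^ l * cos x -
      h * (coef n * m ^ S l * (cos x * 0 - sin x * 1)))
      with (coef n * m ^ l * (cos (x + m * h) - cos x + m * h * sin x)) by (simpl; ring).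
    assert (H0 : 0 <= coef n * m ^ l).
    { apply Rmult_le_pos; [left; apply coef_pos|now apply pow_le]. }
    rewrite Rabs_mult, (Rabs_pos_eq _ H0).
    replace (h ^ 2 * (coef n * m ^ S (S l))) with (coef n * m ^ l * (m * h) ^ 2) by (simpl; ring).
    apply Rmult_le_compat_l; [exact H0|apply cos_taylor]. }
  intros eps He. assert (Hd : 0 < eps / (B + 1)) by (apply Rdiv_lt_0_compat; lra).
  exists (mkposreal _ Hd). intros h Hh0 Hhd. simpl in Hhd.
  replace ((lacunary_deriv l (t + h) - lacunary_deriv l t) / h - lacunary_deriv (S l) t)
    with ((lacunary_deriv l (t + h) - lacunary_deriv l t - h * lacunary_deriv (S l) t) / h)
    by (field; exact Hh0).
  unfold Rdiv. rewrite Rabs_mult, Rabs_inv. assert (Ha := Rabs_pos_lt h Hh0).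
  apply Rlt_div_l; [exact Ha|]. eapply Rle_lt_trans; [apply Hh|].
  rewrite <- pow2_abs. apply (Rmult_lt_compat_r (B + 1)) in Hhd; [|lra].
  replace (eps / (B + 1) * (B + 1)) with eps in Hhd by (field; lra). simpl. nra.
Qed.

Lemma lacunary_expi (t : R) : lacunary (expi t) = (lacunary_deriv 0 t, 0).
Proof.
  unfold lacunary, lacunary_deriv. f_equal. apply Series_ext. intros n.
  rewrite expi_pow. simpl. rewrite Rmult_1_r. do 2 f_equal. ring.
Qed.

(** On the circle twice the real part of [z ^ m] is [z ^ m] plus its inverse; multiplying by [z ^ P]
    clears the negative powers, provided that [P] is at least the frequencies involved, since
    [P - freq k] is truncated. *)
Fixpoint lac_poly (P n : nat) (z : C) : C :=
  match n with
  | O => 0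
  | S k => (lac_poly P k z + coef k * (z ^ (P + freq k) + z ^ (P - freq k)))%C
  end.

Lemma cder_lac_poly (P n : nat) (z : C) : exists l, cder (lac_poly P n) z l.
Proof.
  induction n as [|n [l IH]]; [exists 0%C; apply (cder_const 0)|].
  destruct (cder_pow (P + freq n) z) as [l1 H1], (cder_pow (P - freq n) z) as [l2 H2].
  eexists. apply (cder_plus (lac_poly P n)); [exact IH|].
  apply (cder_mult (fun _ => RtoC (coef n))); [apply cder_const|].
  apply cder_plus; eassumption.
Qed.

Lemma pow_le_one_decr (x : R) (n m : nat) : 0 <= x <= 1 -> (n <= m)%nat -> x ^ m <= x ^ n.
Proof.
  intros Hx H. induction H as [|m H IH]; [lra|]. simpl.
  assert (0 <= x ^ m) by (apply pow_le; lra). nra.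
Qed.

(** Every exponent is at least [g]. Taking [g = 0] gives a uniform bound, a large [g] gives
    smallness at an interior point. *)
Lemma lac_poly_bound (P n g : nat) (z : C) : cl_in z ->
  (forall k, (k < n)%nat -> (freq k + g <= P)%nat) ->
  Cmod (lac_poly P n z) <= 2 * psum coef n * Cmod z ^ g.
Proof.
  intros Hz. unfold cl_in in Hz. assert (Hz0 := Cmod_ge_0 z).
  induction n as [|n IH]; intros Hg; simpl.
  - rewrite Cmod_0. lra.
  - specialize (IH ltac:(intros k Hk; apply Hg; lia)). specialize (Hg n ltac:(lia)).
    eapply Rle_trans; [apply Cmod_triangle|]. rewrite Cmod_mult, Cmod_R.
    rewrite Rabs_pos_eq by (left; apply coef_pos).
    assert (T := Cmod_triangle (z ^ (P + freq n)) (z ^ (P - freq n))). rewrite !Cmod_pow in T.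
    assert (H1 := pow_le_one_decr (Cmod z) g (P + freq n) ltac:(lra) ltac:(lia)).
    assert (H2 := pow_le_one_decr (Cmod z) g (P - freq n) ltac:(lra) ltac:(lia)).
    assert (H3 := coef_pos n). nra.
Qed.

Lemma lac_poly_unit (P n : nat) (z : C) : unit_circle z ->
  (forall k, (k < n)%nat -> (freq k <= P)%nat) ->
  lac_poly P n z =
    Cmult (z ^ P) (RtoC (2 * psum (fun k => coef k * fst (z ^ freq k)%C) n)).
Proof.
  intros Hz. induction n as [|n IH]; intros HP; simpl.
  - rewrite Rmult_0_r. ring.
  - rewrite IH by (intros k Hk; apply HP; lia). specialize (HP n ltac:(lia)).
    set (m := freq n) in *. set (w := (z ^ m)%C). set (y := (z ^ (P - m))%C).
    set (p := psum _ n).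
    assert (EP : (z ^ P)%C = (y * w)%C).
    { unfold y, w. rewrite <- Cpow_add_r. f_equal. lia. }
    assert (E : (w * Cconj w)%C = 1).
    { rewrite <- Cmod2_conj. unfold w. rewrite Cmod_pow, Hz, pow1, RtoC_pow. ring. }
    assert (E2 : RtoC (2 * (coef n * fst w)) = (coef n * (w + Cconj w))%C).
    { apply injective_projections; simpl; ring. }
    rewrite Cpow_add_r, Rmult_plus_distr_l, RtoC_plus, E2, EP. fold w.
    replace (coef n * (y * w * w + y))%C with (coef n * (y * w * w + y * (w * Cconj w)))%C
      by (rewrite E; ring).
    ring.
Qed.

(** [4 ^ (n + k)] is at least [4 ^ n + k], so a geometric series of ratio 1/2 dominates. *)
Lemma coef_tail (n : nat) : Series (fun k => coef (n + k)) <= 2 * coef n.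
Proof.
  apply Rle_trans with (Series (fun k => coef n * (1 / 2) ^ k)).
  - apply Series_le; [|apply ex_series_scaled_geom; lra]. intros k. split; [left; apply coef_pos|].
    assert (E : exp (- INR k) <= (1 / 2) ^ k).
    { induction k as [|k IH]; [simpl; rewrite Ropp_0, exp_0; lra|].
      rewrite S_INR, Ropp_plus_distr, exp_plus. simpl. rewrite Rmult_comm.
      assert (H1 : exp (- (1)) <= 1 / 2).
      { rewrite exp_Ropp. apply Rle_trans with (/ 2); [|lra].
        apply Rinv_le_contravar; [lra|]. assert (H := exp_ineq1_le 1). lra. }
      assert (H2 := exp_pos (- (1))). assert (H3 := exp_pos (- INR k)).
      apply Rmult_le_compat; lra. }
    apply Rle_trans with (coef n * exp (- INR k)).
    + unfold coef. rewrite <- exp_plus. apply exp_le_compat. rewrite pow_add.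
      assert (H1 := pow4_ge n). assert (H2 := pow4_ge k). assert (H3 := pos_INR n).
      assert (H4 := pos_INR k). nra.
    + apply Rmult_le_compat_l; [left; apply coef_pos|exact E].
  - rewrite Series_scal_l, Series_geom by (rewrite Rabs_pos_eq; lra).
    right. field.
Qed.

(** The square root in the two constants theorem turns this into [coef n ^ 2], still negligible
    against [coef n]. *)
Lemma coef_succ (n : nat) : coef (S n) = coef n ^ 4.
Proof.
  unfold coef. simpl. rewrite !Rmult_1_r, <- !exp_plus. f_equal. ring.
Qed.

Lemma coef_le_one (n : nat) : coef n <= 1.
Proof.
  unfold coef. rewrite <- exp_0. apply exp_le_compat.
  assert (H := pow_lt 4 n ltac:(lra)). lra.
Qed.

Lemma psum_coef_le (n : nat) : psum coef n <= Series coef.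
Proof.
  rewrite (Series_psum coef n coef_summable).
  assert (H : 0 <= Series (fun k => coef (n + k))).
  { apply Series_nonneg; [intros k; left; apply coef_pos|].
    apply ex_series_incr_n, coef_summable. }
  lra.
Qed.

Lemma freq_mono (i j : nat) : (i <= j)%nat -> (freq i <= freq j)%nat.
Proof. intros H. apply Nat.pow_le_mono_r; lia. Qed.

Lemma lacunary_tail (P n : nat) (z : C) : unit_circle z ->
  (forall k, (k < n)%nat -> (freq k <= P)%nat) ->
  Cmod (z ^ P * (2 * lacunary z) - lac_poly P n z) <= 4 * coef n.
Proof.
  intros Hz HP. rewrite (lac_poly_unit P n z Hz HP).
  assert (Hterm : forall k, Rabs (coef k * fst (z ^ freq k)%C) <= coef k).
  { intros k. rewrite Rabs_mult, Rabs_pos_eq by (left; apply coef_pos).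
    rewrite <- (Rmult_1_r (coef k)) at 2. apply Rmult_le_compat_l; [left; apply coef_pos|].
    eapply Rle_trans; [apply fst_le_Cmod|]. rewrite Cmod_pow, Hz, pow1. lra. }
  assert (Hex := proj1 (Series_Rabs_le _ _ Hterm coef_summable)).
  assert (E : lacunary z = RtoC (psum (fun k => coef k * fst (z ^ freq k)%C) n +
     Series (fun k => coef (n + k) * fst (z ^ freq (n + k))%C))).
  { unfold lacunary. now rewrite (Series_psum _ n Hex). }
  rewrite E, RtoC_plus, RtoC_mult.
  set (p := psum _ n). set (t := Series (fun k => coef (n + k) * fst (z ^ freq (n + k))%C)).
  replace (z ^ P * (2 * (RtoC p + RtoC t)) - z ^ P * (2 * RtoC p))%C with (z ^ P * RtoC (2 * t))%C
    by (rewrite RtoC_mult; ring).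
  rewrite Cmod_mult, Cmod_pow, Hz, pow1, Rmult_1_l, Cmod_R, Rabs_mult, (Rabs_pos_eq 2) by lra.
  assert (Ht : Rabs t <= Series (fun k => coef (n + k))).
  { apply Series_Rabs_le; [intros k; apply Hterm|]. apply ex_series_incr_n, coef_summable. }
  assert (H := coef_tail n). lra.
Qed.

Lemma exp_neg_pow (tau : R) (n : nat) : exp (- tau) ^ n = exp (- (INR n * tau)).
Proof.
  induction n as [|n IH]; [simpl; now rewrite Rmult_0_l, Ropp_0, exp_0|].
  rewrite S_INR. simpl. rewrite IH, <- exp_plus. f_equal. ring.
Qed.

(** With [x = 4 ^ S j] the gap is [15 / 16 * x ^ 2]. Once [tau * x >= 4], the geometric term is at
    most [K * exp (- x) ^ 2], and the inequality would give [exp x <= 3 * K]. *)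
Lemma coef_gap_contradiction (K rho : R) : 0 < K -> 0 < rho < 1 ->
  ~ forall j, coef (S j) <= 2 * K * coef (S j) ^ 2 + K * rho ^ (freq (S j) - freq j).
Proof.
  intros HK Hrho H. set (tau := - ln rho).
  assert (Htau : 0 < tau).
  { unfold tau. assert (Hl := ln_increasing rho 1 ltac:(lra) ltac:(lra)). rewrite ln_1 in Hl. lra. }
  assert (Erho : rho = exp (- tau)) by (unfold tau; rewrite Ropp_involutive, exp_ln; lra).
  assert (Hit : 0 < 4 / tau) by (apply Rdiv_lt_0_compat; lra).
  (* This [j] makes [x] exceed both [4 * K] and [4 / tau]. *)
  destruct (nfloor_ex (4 * K + 4 / tau)) as [j [_ Hj]]; [lra|].
  specialize (H j). set (x := 4 ^ S j) in *.
  assert (Hx := pow4_ge (S j)). fold x in Hx. rewrite S_INR in Hx.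
  assert (Hgap : INR (freq (S j) - freq j) = 15 / 16 * x ^ 2).
  { rewrite minus_INR by (apply freq_mono; lia). rewrite !INR_freq. unfold x. simpl. field. }
  rewrite Erho, exp_neg_pow, Hgap in H. unfold coef in H. fold x in H.
  assert (Htx : 4 <= tau * x).
  { apply Rle_trans with (tau * (4 / tau)); [right; field; lra|].
    apply Rmult_le_compat_l; lra. }
  assert (He : exp (- (15 / 16 * x ^ 2 * tau)) <= exp (- x) * exp (- x)).
  { rewrite <- exp_plus. apply exp_le_compat. nra. }
  assert (Hex := exp_pos (- x)).
  assert (H1 : exp x * exp (- x) = 1) by (rewrite <- exp_plus, Rplus_opp_r; apply exp_0).
  assert (H2 := exp_ineq1_le x).
  assert (H3 : exp (- x) <= 3 * K * (exp (- x) * exp (- x))) by nra.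
  assert (H4 : 1 <= 3 * K * exp (- x)).
  { apply (Rmult_le_reg_r (exp (- x))); [exact Hex|]. lra. }
  assert (4 * K * exp (- x) < 1); [|nra].
  rewrite <- H1. apply Rmult_lt_compat_r; lra.
Qed.

(* After multiplication by [z ^ freq N] the extension is tiny at a fixed interior point,
   whereas two constants forces it to be close to [coef N] there. *)
Lemma lacunary_no_ext_in (z0 : C) : unit_circle z0 -> ~ locally_ext cl_in op_in z0 lacunary.
Proof.
  intros H0 Hext.
  destruct (ext_at_grid_point cl_in op_in z0 lacunary) as (a & b & G & [HG HGu] & HM).
  { intros z Hz. unfold cl_in. rewrite Hz. lra. } { exact H0. } { exact Hext. }
  set (p := grid_point a b) in *. set (r := / (INR b + 1)) in *. set (M := INR b + 1) in *.
  assert (Hp : unit_circle p) by apply expi_unit.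
  assert (HMp : 0 < M) by (unfold M; assert (H := pos_INR b); lra).
  assert (Hr : 0 < r) by (apply Rinv_0_lt_compat; exact HMp).
  destruct (two_constants_in p r Hp Hr) as (s & [Hs Hsr] & T).
  set (A := Series coef).
  assert (HA : 0 <= A).
  { apply Series_nonneg; [intros n; left; apply coef_pos|apply coef_summable]. }
  (* [2 * M + 2 * A] bounds [g] on the disk; the 4 makes room for [4 * coef (S N)] and for the term
     [c * zeta ^ (P + P)]. *)
  set (K := 2 * M + 2 * A + 4).
  set (h := Rmin (s / 2) (1 / 2)).
  assert (Hh : 0 < h) by (apply Rmin_pos; lra).
  assert (Hh1 : h <= s / 2) by apply Rmin_l. assert (Hh2 : h <= 1 / 2) by apply Rmin_r.
  set (zeta := (RtoC (1 - h) * p)%C).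
  assert (Hzm : Cmod zeta = 1 - h).
  { unfold zeta. rewrite Cmod_mult, Hp, Cmod_R, Rabs_pos_eq; lra. }
  assert (Hzd : disk_part cl_in p s zeta).
  { split; [|unfold cl_in; lra].
    replace (zeta - p)%C with (RtoC (- h) * p)%C
      by (unfold zeta; apply injective_projections; simpl; ring).
    rewrite Cmod_mult, Hp, Cmod_R, Rabs_Ropp, Rabs_pos_eq; lra. }
  apply (coef_gap_contradiction K (1 - h)); [unfold K; lra|lra|]. intros j.
  (* With this [P] the term of index [N] contributes the exponent 0, hence the constant [coef N];
     every other exponent in the polynomial is at least [D]. *)
  set (N := S j). set (P := freq N). set (D := (P - freq j)%nat).
  set (c := coef N). assert (Hc := coef_pos N). assert (Hc1 := coef_le_one N). fold c in Hc, Hc1.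
  set (g := fun z => (z ^ P * (2 * G z) - lac_poly P (S N) z)%C).
  assert (HGz : forall z, disk_part cl_in p r z -> forall n, Cmod (z ^ n * (2 * G z)) <= 2 * M * Cmod z ^ n).
  { intros z Hz n. rewrite !Cmod_mult, Cmod_pow, Cmod_R, Rabs_pos_eq by lra.
    assert (H1 := HM z Hz). assert (H2 : 0 <= Cmod z ^ n) by (apply pow_le, Cmod_ge_0). nra. }
  assert (Hg2 : Cmod (g zeta) ^ 2 <= K * (4 * coef (S N))).
  { apply (T g); [| | | |exact Hzd].
    - destruct HG as [Gc Gd]. split.
      + intros z Hz. apply cont_at_minus.
        * destruct (cder_pow P z) as [l Hl].
          apply cont_at_mult; [now apply (cder_cont_at _ _ l)|].
          apply cont_at_mult; [apply cont_at_const|now apply Gc].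
        * destruct (cder_lac_poly P (S N) z) as [l Hl]. now apply (cder_cont_at _ _ l).
      + intros z Hz. destruct (cder_pow P z) as [l Hl], (Gd z Hz) as [l' Hl'].
        destruct (cder_lac_poly P (S N) z) as [l'' Hl''].
        eexists. apply cder_minus; [|exact Hl''].
        apply (cder_mult (fun z => (z ^ P)%C)); [exact Hl|].
        apply (cder_mult (fun _ => RtoC 2)); [apply cder_const|exact Hl'].
    - assert (H1 := coef_pos (S N)). assert (H2 := coef_le_one (S N)). unfold K. lra.
    - intros z Hz. unfold g, Cminus. eapply Rle_trans; [apply Cmod_triangle|]. rewrite Cmod_opp.
      assert (H1 := HGz z Hz P).
      assert (H2 := lac_poly_bound P (S N) 0 z (proj2 Hz)
        ltac:(intros k Hk; rewrite Nat.add_0_r; apply freq_mono; lia)).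
      assert (H3 := psum_coef_le (S N)). fold A in H3.
      assert (H4 : Cmod z ^ P <= 1).
      { apply (pow_le_one_decr (Cmod z) 0 P); [|lia].
        split; [apply Cmod_ge_0|apply Hz]. }
      change (Cmod z ^ 0) with 1 in H2. unfold K. nra.
    - intros z Hz. unfold g. rewrite (HGu z Hz). apply lacunary_tail; [apply Hz|].
      intros k Hk. apply freq_mono. lia. }
  assert (Hg : Cmod (g zeta) <= 2 * K * c ^ 2).
  { rewrite coef_succ in Hg2. fold c in Hg2.
    assert (HK : 4 <= K) by (unfold K; lra). assert (H := Cmod_ge_0 (g zeta)).
    apply Rnot_lt_le. intros Hlt. assert (Hc4 : 0 < c ^ 4) by now apply pow_lt.
    assert (H1 : K * (4 * c ^ 4) <= (2 * K * c ^ 2) ^ 2).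
    { replace ((2 * K * c ^ 2) ^ 2) with (K * (K * (4 * c ^ 4))) by ring.
      rewrite <- (Rmult_1_l (K * (4 * c ^ 4))) at 1. apply Rmult_le_compat_r; nra. }
    assert (H2 : 0 <= 2 * K * c ^ 2) by (assert (H2 := pow2_ge_0 c); nra). nra. }
  (* Isolates the constant [c]: apart from [g zeta], the other terms are at most a constant times
     [(1 - h) ^ D]. *)
  assert (Egz : g zeta = (zeta ^ P * (2 * G zeta) - (lac_poly P N zeta + RtoC c * zeta ^ (P + P)) - RtoC c)%C).
  { unfold g. simpl lac_poly. fold P. rewrite Nat.sub_diag. simpl (zeta ^ 0)%C. fold c. ring. }
  assert (Hcz : Cmod (RtoC c) <= Cmod (g zeta) + (2 * M + 2 * A + 1) * (1 - h) ^ D).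
  { replace (RtoC c) with (- g zeta + (zeta ^ P * (2 * G zeta) + - (lac_poly P N zeta + RtoC c * zeta ^ (P + P))))%C
      by (rewrite Egz; ring).
    eapply Rle_trans; [apply Cmod_triangle|]. rewrite Cmod_opp. apply Rplus_le_compat_l.
    eapply Rle_trans; [apply Cmod_triangle|]. rewrite Cmod_opp.
    assert (T2 := Cmod_triangle (lac_poly P N zeta) (RtoC c * zeta ^ (P + P))).
    rewrite Cmod_mult, Cmod_pow, Cmod_R, (Rabs_pos_eq c), Hzm in T2 by lra.
    assert (H1 := HGz zeta ltac:(split; [apply Rlt_le_trans with (1 := proj1 Hzd), Hsr|apply Hzd]) P).
    assert (Hle : (freq j <= P)%nat) by (apply freq_mono; unfold N; lia).
    assert (H2 := lac_poly_bound P N D zeta (proj2 Hzd)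
      ltac:(intros k Hk; assert (Hf := freq_mono k j ltac:(unfold N in Hk; lia)); unfold D; lia)).
    rewrite Hzm in H1, H2.
    assert (H3 := psum_coef_le N). fold A in H3.
    assert (H4 := pow_le_one_decr (1 - h) D P ltac:(lra) ltac:(unfold D; lia)).
    assert (H5 := pow_le_one_decr (1 - h) D (P + P) ltac:(lra) ltac:(unfold D; lia)).
    assert (H6 : 0 <= (1 - h) ^ (P + P)) by (apply pow_le; lra).
    assert (H7 : 0 <= (1 - h) ^ D) by (apply pow_le; lra).
    assert (c * (1 - h) ^ (P + P) <= 1 * (1 - h) ^ D) by (apply Rmult_le_compat; lra).
    assert (psum coef N * (1 - h) ^ D <= A * (1 - h) ^ D) by (apply Rmult_le_compat_r; lra).
    assert (M * (1 - h) ^ P <= M * (1 - h) ^ D) by (apply Rmult_le_compat_l; lra).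
    lra. }
  rewrite Cmod_R, Rabs_pos_eq in Hcz by lra.
  assert (H7 : 0 <= (1 - h) ^ D) by (apply pow_le; lra). unfold K in *. nra.
Qed.

(** * Density *)

(** The reflected extension has conjugate boundary values, and [lacunary] is real. *)
Lemma lacunary_no_ext_out (z0 : C) : unit_circle z0 -> ~ locally_ext cl_out op_out z0 lacunary.
Proof.
  intros H0 (r & Hr & G & HG & HGu). apply (lacunary_no_ext_in z0 H0).
  exists (Rmin (r / 2) (1 / 2)). split; [apply Rmin_pos; lra|].
  exists (schwarz_reflect G). split.
  - apply (reflect_regular z0 r); auto using Rmin_l, Rmin_r.
  - intros z [Hz Hzu]. unfold schwarz_reflect. rewrite inversion_unit by exact Hzu.
    rewrite HGu.
    + unfold lacunary, Cconj. simpl. now rewrite Ropp_0.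
    + split; [|exact Hzu]. assert (H := Rmin_l (r / 2) (1 / 2)). lra.
Qed.

Definition perturb (u : C -> C) (c : R) (z : C) : C := (u z + c * lacunary z)%C.

(** For distinct parameters the difference of the extensions, divided by [c - c'], would extend
    [lacunary]. *)
Lemma perturb_ext_unique (cl op : C -> Prop) (z0 : C) (r c c' : R) (u G G' : C -> C) :
  0 < r -> ~ locally_ext cl op z0 lacunary ->
  ext cl op z0 r (perturb u c) G -> ext cl op z0 r (perturb u c') G' -> c = c'.
Proof.
  intros Hr Hn [[Gc Gd] Gu] [[Gc' Gd'] Gu']. apply NNPP. intros Hne. apply Hn.
  exists r. split; [exact Hr|].
  exists (fun z => (RtoC (/ (c - c')) * (G z - G' z))%C). split; [split|].
  - intros z Hz. apply cont_at_mult; [apply cont_at_const|]. apply cont_at_minus; auto.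
  - intros z Hz. destruct (Gd z Hz) as [l Hl], (Gd' z Hz) as [l' Hl'].
    eexists. apply (cder_mult (fun _ => RtoC (/ (c - c')))); [apply cder_const|].
    apply cder_minus; eassumption.
  - intros z Hz. rewrite (Gu z Hz), (Gu' z Hz). unfold perturb.
    apply injective_projections; simpl; field; lra.
Qed.

Lemma exists_generic_perturbation (u : C -> C) (eta : R) : 0 < eta ->
  exists c, 0 <= c <= eta /\ forall z0, unit_circle z0 ->
    ~ locally_ext cl_in op_in z0 (perturb u c) /\ ~ locally_ext cl_out op_out z0 (perturb u c).
Proof.
  intros Heta.
  (* The side is coded by a natural number, every nonzero one meaning the outside, so that side and
     grid point are enumerated by iterated pairing. *)
  set (cl := fun i : nat => match i with O => cl_in | _ => cl_out end).
  set (op := fun i : nat => match i with O => op_in | _ => op_out end).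
  assert (Hlac : forall i z0, unit_circle z0 -> ~ locally_ext (cl i) (op i) z0 lacunary).
  { intros [|i]; [exact lacunary_no_ext_in|exact lacunary_no_ext_out]. }
  set (bad := fun i a b c => exists G,
    ext (cl i) (op i) (grid_point a b) (/ (INR b + 1)) (perturb u c) G).
  assert (Hs : forall n, exists x, forall c,
    bad (fst (of_nat n)) (fst (of_nat (snd (of_nat n)))) (snd (of_nat (snd (of_nat n)))) c -> c = x).
  { intros n. set (i := fst (of_nat n)). set (a := fst (of_nat (snd (of_nat n)))).
    set (b := snd (of_nat (snd (of_nat n)))).
    destruct (classic (exists x, bad i a b x)) as [[x [G HG]]|Hno].
    - exists x. intros c [G' HG'].
      apply (perturb_ext_unique (cl i) (op i) (grid_point a b) (/ (INR b + 1)) c x u G' G).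
      + apply Rinv_0_lt_compat. assert (H := pos_INR b). lra.
      + apply Hlac, expi_unit.
      + exact HG'.
      + exact HG.
    (* Without a bad parameter, 0 is a placeholder. *)
    - exists 0. intros c Hc. exfalso. eauto. }
  set (s := fun n => proj1_sig (constructive_indefinite_description _ (Hs n))).
  assert (Hbad : forall i a b c, bad i a b c -> exists n, c = s n).
  { intros i a b c Hc. exists (to_nat (i, to_nat (a, b))). unfold s.
    destruct constructive_indefinite_description as [x Hx]. simpl.
    apply Hx. rewrite cancel_of_to. cbn [fst snd]. rewrite cancel_of_to. exact Hc. }
  destruct (exists_avoiding_sequence s 0 eta Heta) as (c & Hc & Hcs).
  exists c. split; [exact Hc|]. intros z0 H0.
  assert (Hall : forall i, ~ locally_ext (cl i) (op i) z0 (perturb u c)).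
  { intros i Hext.
    destruct (ext_at_grid_point (cl i) (op i) z0 (perturb u c)) as (a & b & G & HG & _).
    - intros z Hz. destruct i; simpl; unfold cl_in, cl_out; rewrite Hz; lra.
    - exact H0.
    - exact Hext.
    - destruct (Hbad i a b c) as [n Hn]; [exists G; exact HG|]. exact (Hcs n Hn). }
  split; [exact (Hall O)|exact (Hall 1%nat)].
Qed.

Lemma perturb_derivs (k : kreg) (u : C -> C) (c : R) (d : nat -> R -> C) :
  derivs k (fun t => u (expi t)) d ->
  derivs k (fun t => perturb u c (expi t))
    (fun l t => (fst (d l t) + c * lacunary_deriv l t, snd (d l t))).
Proof.
  intros (Hd0 & Hdc & Hdd). repeat split.
  - intros t. unfold perturb. rewrite lacunary_expi, <- Hd0.
    apply injective_projections; simpl; ring.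
  - simpl. apply continuity_plus; [now apply Hdc|]. apply continuity_scal.
    intros t. apply derivable_continuous_pt. eexists. apply lacunary_deriv_correct.
  - now apply Hdc.
  - simpl. apply derivable_pt_lim_plus; [now apply Hdd|].
    apply derivable_pt_lim_scal, lacunary_deriv_correct.
  - now apply Hdd.
Qed.

(** A basic neighbourhood involves finitely many orders even for [k = Inf], so one range of
    parameters keeps all the derivatives in question close. *)
Lemma exists_small_multiple (B : nat -> R) (N : nat) (eps : R) :
  0 < eps -> (forall l, 0 <= B l) ->
  exists eta, 0 < eta /\ forall l, (l <= N)%nat -> eta * B l < eps.
Proof.
  intros He HB.
  assert (Hle : forall l, (l <= N)%nat -> B l <= psum B (S N)).
  { assert (Hp : forall n, 0 <= psum B n).
    { induction n as [|n IH]; simpl; [lra|]. specialize (HB n). lra. }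
    induction N as [|N IH]; intros l Hl.
    - replace l with O by lia. simpl. lra.
    - assert (H := HB (S N)). assert (H' := Hp (S N)). simpl in *.
      destruct (Nat.eq_dec l (S N)) as [->|Hne]; [lra|]. specialize (IH l ltac:(lia)). lra. }
  set (m := psum B (S N)) in *. assert (Hm : 0 <= m) by (specialize (Hle O ltac:(lia)); specialize (HB O); lra).
  exists (eps / (m + 1)). split; [apply Rdiv_lt_0_compat; lra|]. intros l Hl. specialize (Hle l Hl).
  apply Rle_lt_trans with (eps / (m + 1) * m).
  - apply Rmult_le_compat_l; [left; apply Rdiv_lt_0_compat; lra|exact Hle].
  - replace (eps / (m + 1) * m) with (eps * m / (m + 1)) by (field; lra).
    apply Rlt_div_l; lra.
Qed.

(** U4 is contained in U2 and U3, and through U3 in U5, so all four densities follow from this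
    one. *)
Lemma U4_dense (k : kreg) : Ck_dense k (Uall U4z k).
Proof.
  split.
  { intros u Hu. apply (inCk_of_Uall U4z); [intros z0 Hz; apply Hz|exact Hu]. }
  intros u d N eps Hd HN He.
  destruct (exists_small_multiple (fun l => Series (fun n => coef n * INR (freq n) ^ l)) N eps He)
    as (eta & Heta & Hsmall).
  { intros l. apply Series_nonneg; [|apply coef_freq_summable]. intros n.
    apply Rmult_le_pos; [left; apply coef_pos|apply pow_le, pos_INR]. }
  destruct (exists_generic_perturbation u eta Heta) as (c & Hc & Hgen).
  assert (Hder := perturb_derivs k u c d Hd).
  exists (perturb u c). eexists. split; [|split; [exact Hder|]].
  - apply U4_iff. rewrite U2_iff, U3_iff.
    split; (split; [eexists; exact Hder|]); intros z0 H0; now apply Hgen.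
  - intros l Hl t. rewrite Cnorm_Cmod. specialize (Hsmall l Hl).
    eapply Rle_lt_trans; [apply Cmod_le_sum|]. simpl.
    replace (fst (d l t) + c * lacunary_deriv l t - fst (d l t)) with (c * lacunary_deriv l t) by ring.
    rewrite Rminus_diag, Rabs_R0, Rplus_0_r, Rabs_mult, (Rabs_pos_eq c) by lra.
    eapply Rle_lt_trans; [|exact Hsmall].
    apply Rmult_le_compat; [lra|apply Rabs_pos|lra|apply lacunary_deriv_bound].
Qed.

Lemma Ck_dense_superset (k : kreg) (A B : (C -> C) -> Prop) :
  (forall u, A u -> B u) -> (forall u, B u -> inCk k u) -> Ck_dense k A -> Ck_dense k B.
Proof.
  intros HAB HB [_ HA]. split; [exact HB|]. intros u d N eps Hd HN He.
  destruct (HA u d N eps Hd HN He) as (v & e & Hv & H). exists v, e. split; [now apply HAB|exact H].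
Qed.

Theorem theorem3p18 (k : kreg) :
  dense_Gdelta k (Uall U2z k) /\ dense_Gdelta k (Uall U3z k) /\
  dense_Gdelta k (Uall U4z k) /\ dense_Gdelta k (Uall U5z k).
Proof.
  assert (G2 : Ck_Gdelta k (Uall U2z k)).
  { apply (Gdelta_iff k (nowhere_ext cl_out op_out k)); [intros u; symmetry; apply U2_iff|].
    apply nowhere_ext_Gdelta; [exact two_constants_out|exact open_op_out|..];
      intros z Hz; unfold op_out, cl_out, unit_circle in *; lra. }
  assert (G3 : Ck_Gdelta k (Uall U3z k)).
  { apply (Gdelta_iff k (nowhere_ext cl_in op_in k)); [intros u; symmetry; apply U3_iff|].
    apply nowhere_ext_Gdelta; [exact two_constants_in|exact open_op_in|..];
      intros z Hz; unfold op_in, cl_in, unit_circle in *; lra. }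
  assert (G5 : Ck_Gdelta k (Uall U5z k)).
  { apply (Gdelta_iff k (nowhere_ext everywhere everywhere k));
      [intros u; symmetry; apply U5_iff|].
    apply nowhere_ext_Gdelta; [exact two_constants_everywhere|exact open_everywhere|..];
      intros z _; exact I. }
  assert (D4 := U4_dense k).
  split; [|split; [|split]]; (split; [|assumption || idtac]).
  - apply (Ck_dense_superset k (Uall U4z k)); [intros u Hu; now apply U4_iff|..|exact D4].
    intros u Hu. now apply U2_iff.
  - apply (Ck_dense_superset k (Uall U4z k)); [intros u Hu; now apply U4_iff|..|exact D4].
    intros u Hu. now apply U3_iff.
  - exact D4.
  - apply (Gdelta_iff k (fun u => Uall U2z k u /\ Uall U3z k u));
      [intros u; symmetry; apply U4_iff|now apply Gdelta_and].
  - apply (Ck_dense_superset k (Uall U4z k)); [|intros u Hu; now apply U5_iff|exact D4].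
    intros u Hu. apply Uall_U3_U5. now apply U4_iff.
Qed.
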